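(* Let $n$ be a fixed odd number, $m\ge0$, and let $\Omega$ be an axially symmetric slice domain in $\mathbb{R}^{n+1}$ containing $0$. Let $g\in\mathcal{SP}_{m+1}(\Omega)$ have the series expansion $g(x)=\sum_{k=0}^m\sum_{s=0}^\infty\bar x^kx^s\alpha_{k,s}$, $\alpha_{k,s}\in\mathbb{R}_n$, in a neighbourhood of $0$. Then the image of $g$ under $\mathcal{C}_{m+1}$ is given, in a neighbourhood of $0$, by $$\mathcal{C}_{m+1}(g)(x)=\sum_{k=0}^m\sum_{s=0}^\infty\mathcal{A}_{k,s}^n(x)\,\beta_{k,s},\qquad \beta_{k,s}=\left[\Gamma\left(\tfrac{n+1}{2}\right)\right]^2 2^{n-1}(-1)^{\frac{n-1}{2}}\frac{(n)_s}{s!}\,\alpha_{k,s+n-1}.$$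
   Context: $\mathbb{R}_n$ is the real Clifford algebra generated by $e_1,\dots,e_n$ with $e_\ell e_m+e_me_\ell=0$ for $\ell\ne m$ and $e_\ell^2=-1$. A point $(x_0,\dots,x_n)\in\mathbb{R}^{n+1}$ is identified with the paravector $x=x_0+\underline{x}$, $\underline{x}=\sum_{\ell=1}^n x_\ell e_\ell$; $\bar x=x_0-\underline{x}$. $\Delta_{\mathbb{R}^{n+1}}=\sum_{i=0}^n\partial_{x_i}^2$. $(a)_0=1$ and $(a)_s=a(a+1)\cdots(a+s-1)$ for $s>0$. The Clifford-Appell polynomials are $$P_k^n(x):=\sum_{s=0}^k T_s^k(n)\,x^{k-s}\bar x^{s},\qquad T_s^k(n):=\binom{k}{s}\frac{\left(\frac{n+1}{2}\right)_{k-s}\left(\frac{n-1}{2}\right)_s}{(n)_k},$$ and $\mathcal{A}_{k,s}^n(x):=x_0^kP_s^n(x)$. $\mathbb{S}^{n-1}$ is the set of $I=\sum_{\ell=1}^n x_\ell e_\ell$ with $\sum x_\ell^2=1$, and $\mathbb{C}_I=\mathbb{R}+I\mathbb{R}$. An axially symmetric slice domain is a domain $\Omega\subseteq\mathbb{R}^{n+1}$ with $\Omega\cap\mathbb{R}\ne\emptyset$, with $\Omega\cap\mathbb{C}_I$ a domain in $\mathbb{C}_I$ for all $I\in\mathbb{S}^{n-1}$, and such that $u+Iv\in\Omega$ for some $I$ implies $u+Jv\in\Omega$ for all $J\in\mathbb{S}^{n-1}$. A function $f$ on $\Omega$ is slice monogenic if $(\partial_u+I\partial_v)f(u+Iv)=0$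 on $\Omega\cap\mathbb{C}_I$ for each $I\in\mathbb{S}^{n-1}$. A $C^{m+1}$ function $f:\Omega\to\mathbb{R}_n$ is slice polyanalytic of order $m+1$, $f\in\mathcal{SP}_{m+1}(\Omega)$, if it is a slice function (i.e. $f(u+Iv)=\alpha(u,v)+I\beta(u,v)$ with $\alpha$ even and $\beta$ odd in $v$) and $(\partial_u+I\partial_v)^{m+1}f(u+Iv)=0$ for all $I\in\mathbb{S}^{n-1}$. Every such $f$ has a unique decomposition $f(x)=\sum_{k=0}^m\bar x^kf_k(x)$ with $f_0,\dots,f_m$ slice monogenic on $\Omega$; expanding each $f_k(x)=\sum_{s\ge0}x^s\alpha_{k,s}$ near $0$ gives the series expansion of $f$. The first polyanalytic Fueter-Sce map is $\mathcal{C}_{m+1}(f)(x):=\sum_{k=0}^m x_0^k\,\Delta_{\mathbb{R}^{n+1}}^{\frac{n-1}{2}}f_k(x)$. *)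

(* Defs.v *)
From HB Require Import structures.
From mathcomp Require Import all_boot all_order all_algebra.
From mathcomp Require Import all_classical all_reals all_analysis.
From mathcomp Require Import ring.

Set Implicit Arguments.
Unset Strict Implicit.
Unset Printing Implicit Defensive.

Import Order.TTheory GRing.Theory Num.Theory.
Import numFieldNormedType.Exports.

Local Open Scope classical_set_scope.
Local Open Scope ring_scope.

(* The real Clifford algebra R_n, in coordinates with respect to the basis of
   blades e_A = e_(i1) ... e_(ir) with A = {i1 < ... < ir}; the generators
   e_1, ..., e_n are indexed by 'I_n.  Row vectors provide the (finite
   dimensional) topology and the derivatives. *)
Definition clifford (R : realType) (n : nat) := 'rV[R]_(#|{set 'I_n}|).

HB.instance Definition _ (R : realType) (n : nat) :=
  NormedModule.on (clifford R n).

Section CliffordAlgebra.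
Variables (R : realType) (n : nat).
Implicit Types (A B C : {set 'I_n}) (a b c : clifford R n).

Definition blade A : clifford R n := delta_mx 0 (enum_rank A).

Definition coef a A : R := a 0 (enum_rank A).

Definition symdiff A B : {set 'I_n} := (A :\: B) :|: (B :\: A).

(* e_A e_B = csign A B e_(A symdiff B): each pair i in A, j in B with j < i
   costs one transposition, and each common index costs e_i ^ 2 = -1. *)
Definition csign A B : R :=
  \prod_(i in A) \prod_(j in B) (-1) ^+ (j <= i)%N.

Definition cmul a b : clifford R n :=
  \sum_(A : {set 'I_n}) \sum_(B : {set 'I_n})
    (csign A B * coef a A * coef b B) *: blade (symdiff A B).

Definition cone : clifford R n := blade finset.set0.

Lemma coefD a b A : coef (a + b) A = coef a A + coef b A.
Proof. by rewrite /coef mxE. Qed.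

Lemma coefZ (k : R) a A : coef (k *: a) A = k * coef a A.
Proof. by rewrite /coef mxE. Qed.

Lemma coef_blade A B : coef (blade A) B = (A == B)%:R.
Proof.
rewrite /coef /blade mxE eqxx /= eq_sym.
by rewrite (inj_eq enum_rank_inj).
Qed.

Lemma clifford_sum a : a = \sum_A coef a A *: blade A.
Proof.
apply/rowP => j; rewrite summxE (bigD1 (enum_val j)) //= big1 ?addr0.
  by rewrite /coef /blade !mxE !enum_valK !eqxx mulr1.
move=> A Aj; rewrite !mxE eqxx /=; case: eqP => [e|_]; last by rewrite mulr0.
by rewrite e enum_rankK eqxx in Aj.
Qed.

Lemma cmulDl : left_distributive cmul +%R.
Proof.
move=> a b c; rewrite /cmul -big_split; apply: eq_bigr => A _ /=.
rewrite -big_split; apply: eq_bigr => B _ /=.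
by rewrite coefD -scalerDl mulrDr mulrDl.
Qed.

Lemma cmulDr : right_distributive cmul +%R.
Proof.
move=> a b c; rewrite /cmul -big_split; apply: eq_bigr => A _ /=.
rewrite -big_split; apply: eq_bigr => B _ /=.
by rewrite coefD -scalerDl mulrDr.
Qed.

Lemma cmulZl (k : R) a b : cmul (k *: a) b = k *: cmul a b.
Proof.
rewrite /cmul scaler_sumr; apply: eq_bigr => A _.
rewrite scaler_sumr; apply: eq_bigr => B _.
by rewrite coefZ scalerA mulrCA !mulrA.
Qed.

Lemma cmulZr (k : R) a b : cmul a (k *: b) = k *: cmul a b.
Proof.
rewrite /cmul scaler_sumr; apply: eq_bigr => A _.
rewrite scaler_sumr; apply: eq_bigr => B _.
by rewrite coefZ scalerA mulrCA !mulrA.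
Qed.

Lemma cmul0l a : cmul 0 a = 0.
Proof. by rewrite -[X in cmul X _](scale0r (0 : clifford R n)) cmulZl scale0r. Qed.

Lemma cmul0r a : cmul a 0 = 0.
Proof. by rewrite -[X in cmul _ X](scale0r (0 : clifford R n)) cmulZr scale0r. Qed.

Lemma cmul_suml I (r : seq I) (F : I -> clifford R n) b :
  cmul (\sum_(i <- r) F i) b = \sum_(i <- r) cmul (F i) b.
Proof.
by elim: r => [|i r IH]; rewrite ?big_nil ?cmul0l // !big_cons cmulDl IH.
Qed.

Lemma cmul_sumr I (r : seq I) (F : I -> clifford R n) b :
  cmul b (\sum_(i <- r) F i) = \sum_(i <- r) cmul b (F i).
Proof.
by elim: r => [|i r IH]; rewrite ?big_nil ?cmul0r // !big_cons cmulDr IH.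
Qed.

Lemma cmul_blade A B : cmul (blade A) (blade B) = csign A B *: blade (symdiff A B).
Proof.
rewrite /cmul (bigD1 A) //= (bigD1 B) //= !coef_blade !eqxx !mulr1.
rewrite !big1 ?addr0 // => C CA.
  by rewrite big1 // => D _; rewrite coef_blade eq_sym (negbTE CA) mulr0 mul0r scale0r.
by rewrite coef_blade eq_sym (negbTE CA) mulr0 scale0r.
Qed.

Lemma symdiffA : associative symdiff.
Proof.
move=> A B C; apply/finset.setP => i; rewrite !inE.
by case: (i \in A); case: (i \in B); case: (i \in C).
Qed.

Lemma prod_symdiff (f : 'I_n -> R) A B : (forall i, f i * f i = 1) ->
  \prod_(i in symdiff A B) f i = (\prod_(i in A) f i) * \prod_(i in B) f i.
Proof.
move=> f1; rewrite [LHS]big_mkcond [X in X * _]big_mkcond [X in _ * X]big_mkcond.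
rewrite -big_split; apply: eq_bigr => i _ /=; rewrite !inE.
by case: (i \in A); case: (i \in B); rewrite /= ?f1 ?mulr1 ?mul1r.
Qed.

Lemma csignDl A B C : csign (symdiff A B) C = csign A C * csign B C.
Proof.
rewrite /csign prod_symdiff // => i; rewrite -big_split big1 // => j _ /=.
by rewrite -signr_addb addbb.
Qed.

Lemma csignDr A B C : csign A (symdiff B C) = csign A B * csign A C.
Proof.
rewrite /csign -big_split; apply: eq_bigr => i _ /=.
by rewrite prod_symdiff // => j; rewrite -signr_addb addbb.
Qed.

Lemma cmulA : associative cmul.
Proof.
move=> a b c; rewrite (clifford_sum a) (clifford_sum b) (clifford_sum c).
set sb := \sum_A coef b A *: _; set sc := \sum_A coef c A *: _.
transitivity (\sum_A \sum_B \sum_C cmul (coef a A *: blade A)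
    (cmul (coef b B *: blade B) (coef c C *: blade C))).
  rewrite cmul_suml; apply: eq_bigr => A _; rewrite /sb (cmul_suml _ _ sc).
  rewrite cmul_sumr; apply: eq_bigr => B _.
  by rewrite /sc (cmul_sumr _ _ (coef b B *: _)) cmul_sumr.
rewrite (cmul_suml _ _ sb) (cmul_suml _ _ sc); apply: eq_bigr => A _.
rewrite /sb (cmul_sumr _ _ (coef a A *: _)) (cmul_suml _ _ sc).
apply: eq_bigr => B _; rewrite /sc cmul_sumr; apply: eq_bigr => C _.
rewrite !(cmulZl, cmulZr, cmul_blade) !scalerA symdiffA csignDl csignDr.
by congr (_ *: _); ring.
Qed.

Lemma symdiff0l A : symdiff finset.set0 A = A.
Proof. by apply/finset.setP => i; rewrite !inE; case: (i \in A). Qed.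

Lemma symdiff0r A : symdiff A finset.set0 = A.
Proof. by apply/finset.setP => i; rewrite !inE; case: (i \in A). Qed.

Lemma cmul1l : left_id cone cmul.
Proof.
move=> a; rewrite [in LHS](clifford_sum a) [RHS]clifford_sum cmul_sumr.
apply: eq_bigr => A _; rewrite cmulZr cmul_blade symdiff0l /csign.
by rewrite big_set0 scale1r.
Qed.

Lemma cmul1r : right_id cone cmul.
Proof.
move=> a; rewrite [in LHS](clifford_sum a) [RHS]clifford_sum cmul_suml.
apply: eq_bigr => A _; rewrite cmulZl cmul_blade symdiff0r /csign.
by rewrite big1 ?scale1r // => i _; rewrite big_set0.
Qed.

Lemma cone_neq0 : cone != 0.
Proof.
apply/eqP => /(congr1 (fun a => coef a finset.set0)) /eqP.
by rewrite coef_blade eqxx /coef mxE oner_eq0.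
Qed.

End CliffordAlgebra.

HB.instance Definition _ (R : realType) (n : nat) :=
  GRing.Zmodule_isNzRing.Build (clifford R n) (@cmulA R n) (@cmul1l R n)
    (@cmul1r R n) (@cmulDl R n) (@cmulDr R n) (@cone_neq0 R n).

HB.instance Definition _ (R : realType) (n : nat) :=
  GRing.Lmodule_isLalgebra.Build R (clifford R n)
    (fun k a b => esym (@cmulZl R n k a b)).

HB.instance Definition _ (R : realType) (n : nat) :=
  GRing.Lalgebra_isAlgebra.Build R (clifford R n)
    (fun k a b => esym (@cmulZr R n k a b)).

Section Clifford.
Variables (R : realType) (n : nat).

Definition gen (l : 'I_n) : clifford R n := blade R [set l]%SET.

Lemma gen_sqr (l : 'I_n) : gen l * gen l = -1.
Proof.
rewrite [LHS]cmul_blade /csign !big_set1 leqnn expr1 scaleN1r; congr (- blade _ _).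
by apply/finset.setP => i; rewrite !inE; case: eqP.
Qed.

Lemma gen_anticomm (l k : 'I_n) : l != k -> gen l * gen k + gen k * gen l = 0.
Proof.
move=> lk; rewrite ![_ * _]cmul_blade /csign !big_set1.
have -> : symdiff [set k]%SET [set l]%SET = symdiff [set l]%SET [set k]%SET.
  by rewrite /symdiff finset.setUC.
rewrite -scalerDl; case: (ltngtP l k) => [_|_|/val_inj e].
- by rewrite expr0 expr1 subrr scale0r.
- by rewrite expr0 expr1 addNr scale0r.
- by rewrite e eqxx in lk.
Qed.

Local Notation pt := 'rV[R]_n.+1.

(* The coordinate x_0 is x 0 0; the coordinate along gen l is
   x 0 (lift ord0 l). *)
Definition re (x : pt) : R := x 0 0.

Definition ve (x : pt) : clifford R n := \sum_(l < n) x 0 (lift ord0 l) *: gen l.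

Definition para (x : pt) : clifford R n := (re x)%:A + ve x.

Definition para_conj (x : pt) : clifford R n := (re x)%:A - ve x.

(* An element I of S^(n-1) is given by its coordinates w in R^n. *)
Definition sphere : set 'rV[R]_n := [set w | \sum_(l < n) w 0 l ^+ 2 = 1].

Definition imag (w : 'rV[R]_n) : clifford R n := \sum_(l < n) w 0 l *: gen l.

(* the point u + I v of R^(n+1) *)
Definition slice_pt (w : 'rV[R]_n) (p : R * R) : pt :=
  \row_i oapp (fun l => p.2 * w 0 l) p.1 (unlift ord0 i).

(* Omega `&` C_I, in the coordinates (u, v) of C_I *)
Definition slice (w : 'rV[R]_n) (Omega : set pt) : set (R * R) :=
  [set p | Omega (slice_pt w p)].

Definition axially_symmetric_slice_domain (Omega : set pt) : Prop :=
  [/\ open Omega /\ connected Omega,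
      exists u : R, Omega (slice_pt 0 (u, 0)),
      forall w, sphere w ->
        [/\ slice w Omega !=set0, open (slice w Omega)
          & connected (slice w Omega)]
    & forall w w' p, sphere w -> sphere w' ->
        Omega (slice_pt w p) -> Omega (slice_pt w' p)].

Definition partial (i : 'I_n.+1) (f : pt -> clifford R n) : pt -> clifford R n :=
  fun x => 'D_(delta_mx 0 i) f x.

(* C^k on Omega: Frechet differentiable with all partial derivatives C^(k-1). *)
Fixpoint Ck (k : nat) (Omega : set pt) (f : pt -> clifford R n) : Prop :=
  match k with
  | 0 => forall x, Omega x -> {for x, continuous f}
  | k'.+1 => (forall x, Omega x -> differentiable f x)
             /\ forall i, Ck k' Omega (partial i f)
  end.

Definition laplacian (f : pt -> clifford R n) : pt -> clifford R n :=
  fun x => \sum_(i < n.+1) partial i (partial i f) x.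

(* the operator d_u + I d_v *)
Definition dbar (w : 'rV[R]_n) (F : R * R -> clifford R n) : R * R -> clifford R n :=
  fun p => 'D_(1, 0) F p + imag w * 'D_(0, 1) F p.

(* 'D is a total operator, so real differentiability of the restriction of f to
   C_I is required explicitly. *)
Definition slice_monogenic (Omega : set pt) (f : pt -> clifford R n) : Prop :=
  forall w, sphere w -> forall p, slice w Omega p ->
    differentiable (f \o slice_pt w) p /\ dbar w (f \o slice_pt w) p = 0.

(* Only the values of a and b at the (u, v) with u + I v in Omega matter; this
   set is symmetric in v, so total even/odd functions lose nothing. *)
Definition slice_function (Omega : set pt) (f : pt -> clifford R n) : Prop :=
  exists a b : R -> R -> clifford R n,
    [/\ forall u v, a u (- v) = a u v,
        forall u v, b u (- v) = - b u v
      & forall w, sphere w -> forall u v, slice w Omega (u, v) ->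
          f (slice_pt w (u, v)) = a u v + imag w * b u v].

Definition slice_polyanalytic (p : nat) (Omega : set pt)
    (f : pt -> clifford R n) : Prop :=
  [/\ Ck p Omega f, slice_function Omega f
    & forall w, sphere w -> forall z, slice w Omega z ->
        iter p (dbar w) (f \o slice_pt w) z = 0].

Definition polyanalytic_decomposition (p : nat) (Omega : set pt)
    (f : pt -> clifford R n) : set ('I_p -> pt -> clifford R n) :=
  [set f_ | (forall k, slice_monogenic Omega (f_ k))
            /\ forall x, Omega x -> f x = \sum_(k < p) para_conj x ^+ k * f_ k x].

(* The first polyanalytic Fueter-Sce map of order p.  The decomposition of a
   slice polyanalytic f is unique on Omega, so there the choice of the
   components made by xget is immaterial. *)
Definition fueter_sce (p : nat) (Omega : set pt) (f : pt -> clifford R n) :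
    pt -> clifford R n :=
  fun x => \sum_(k < p)
    re x ^+ k *: iter ((n - 1) %/ 2) laplacian
      (xget (fun _ _ => 0) (@polyanalytic_decomposition p Omega f) k) x.

End Clifford.

Definition pochhammer (R : realType) (a : R) (s : nat) : R :=
  \prod_(i < s) (a + i%:R).

(* Euler's integral, meaningful for 0 < a. *)
Definition Gamma (R : realType) (a : R) : R :=
  \int[lebesgue_measure]_(t in `]0, +oo[) (t `^ (a - 1) * expR (- t)).

Section Appell.
Variables (R : realType) (n : nat).

Definition appell_coef (k s : nat) : R :=
  'C(k, s)%:R * (pochhammer ((n%:R + 1) / 2) (k - s)
                 * pochhammer ((n%:R - 1) / 2) s / pochhammer n%:R k).

Definition appell_poly (k : nat) (x : 'rV[R]_n.+1) : clifford R n :=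
  \sum_(s < k.+1) appell_coef k s *: (para x ^+ (k - s) * para_conj x ^+ s).

Definition appell_A (k s : nat) (x : 'rV[R]_n.+1) : clifford R n :=
  re x ^+ k *: appell_poly s x.

(* v = sum_(k < p) sum_(s >= 0) a k s, every inner series being convergent *)
Definition has_expansion (p : nat) (a : 'I_p -> nat -> clifford R n)
    (v : clifford R n) : Prop :=
  (forall k, cvgn (series (a k))) /\ v = \sum_(k < p) limn (series (a k)).

End Appell.

(* Main.v *)
(* On every slice, dbar = d_u + I d_v lowers the degree in conj x, so the
   components f_k are recovered from the iterated derivatives dbar^j g by an
   inverse Taylor formula; being stem functions, they are well defined on Omega,
   and the same degree argument makes them unique.  Near 0 they are therefore
   the power series f_k(x) = sum_s x^s alpha_(k,s), which may be differentiated
   termwise.  It remains to apply the Laplacian h = (n-1)/2 times to x^s.  With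
   H_(j,s) the degree s part of (1 - x)^(-j) (1 - conj x)^(1-j), so that
   H_(1,s) = x^s and H_(h+1,s) = (n)_s / s! P_s^n, one has
   Delta H_(j,s+2) = -4 j (h+1-j) H_(j+1,s): the recurrence obtained by
   multiplying by the scalar |1 - x|^2 = 1 - 2 x_0 + |x|^2 reduces this to the
   product rules for x_0 f and |x|^2 f and Euler's identity.  The constants
   multiply to (-4)^h (h!)^2, and h! = Gamma((n+1)/2). *)
Require Import Defs.
From HB Require Import structures.
From mathcomp Require Import all_boot all_order all_algebra.
From mathcomp Require Import all_classical all_reals all_analysis.
From mathcomp Require Import ring lra.

Set Implicit Arguments.
Unset Strict Implicit.
Unset Printing Implicit Defensive.

Import Order.TTheory GRing.Theory Num.Theory.
Import numFieldNormedType.Exports.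

Local Open Scope classical_set_scope.
Local Open Scope ring_scope.

(** * The Gamma function at positive integers *)

(** The family H_(j,s) comes from the closed form (1 - x)^(-j) (1 - conj x)^(1-j) = (1 - conj x) /
    |1 - x|^(2j). The Laplacian sends it to -4 j (h+1-j) times the same expression with j+1, so a
    family indexed by j is closed under the Laplacian, while the powers of x are not. The factor
    vanishes at j = h+1, where the expression is the monogenic Cauchy kernel (1 - conj x) / |1 -
    x|^(n+1). Taking homogeneous parts confines the explicit computation to polynomials. All series
    are handled in one small ball. Convergence at a single real point forces geometric growth of the
    coefficients; the radius is then shrunk until every series in play, with up to two derivatives,
    is dominated by a multiple of (1/2)^s. Such crude majorants suffice because the claim is local
    at 0. Since [fueter_sce] selects the components by [xget], which returns zero functions if there
    is no decomposition, existence has to be proved on all of Omega, whereas uniqueness is used only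
    in the ball. *)

(** The recursion is integration by parts, the constant being fixed so that the primitive vanishes
    at infinity. *)
Fixpoint gamma_primitive (R : realType) (N : nat) (t : R) : R :=
  if N is N'.+1 then N%:R * gamma_primitive N' t - t ^+ N * expR (- t)
  else - expR (- t).

(** The term of degree N + 1 of the exponential series is below exp t, so the function is squeezed
    between 0 and a multiple of 1/t. *)
Lemma cvgr_exprMexpRN (R : realType) (N : nat) :
  (t ^+ N * expR (- t) : R) @[t --> +oo] --> (0 : R).
Proof.
apply: (@squeeze_cvgr _ _ _ _ (cst 0) (fun t : R => N.+1`!%:R * t^-1)).
- near=> t.
  have t0 : 0 < t by near: t; exact: nbhs_pinfty_gt.
  rewrite mulr_ge0 ?exprn_ge0 ?expR_ge0 ?(ltW t0)//= expRN.
  rewrite ler_pdivrMr ?expR_gt0// mulrAC ler_pdivlMr//.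
  rewrite -exprSr mulrC -ler_pdivrMr ?ltr0n ?fact_gt0//.
  by apply: (le_trans _ (expR_ge1Dxn N (ltW t0))); rewrite lerDr.
- exact: cvg_cst.
- rewrite -[X in _ --> X](mulr0 N.+1`!%:R).
  by apply: cvgMl_tmp; apply/gtr0_cvgV0; [near=> t; near: t; exact: nbhs_pinfty_gt | exact: cvg_id].
Unshelve. all: by end_near. Qed.

Lemma cvgr_gamma_primitive (R : realType) (N : nat) :
  gamma_primitive N t @[t --> +oo] --> (0 : R).
Proof.
elim: N => [|N IH] /=; first by rewrite -oppr0; apply: cvgN; exact: cvgr_expR.
rewrite -[X in _ --> X](subr0 0) -[X in _ --> X - _](mulr0 N.+1%:R).
by apply: cvgB; [exact: cvgMl_tmp | exact: (@cvgr_exprMexpRN _ N.+1)].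
Qed.

Lemma is_derive_gamma_primitive (R : realType) (N : nat) (t : R) :
  is_derive t 1 (@gamma_primitive R N) (t ^+ N * expR (- t)).
Proof.
have dexp (u : R) : is_derive u 1 (fun t => expR (- t)) (- expR (- u)).
  by apply: (is_derive_eq (is_derive1_comp _ _)); rewrite /= mulrN1.
elim: N => [|N IH] /=.
  by apply: (is_derive_eq (is_deriveN (dexp t))); rewrite expr0 mul1r opprK.
have dX : is_derive t 1 (fun t : R => t ^+ N.+1) (N.+1%:R * t ^+ N).
  rewrite (_ : (fun t => _) = (id : R -> R) ^+ N.+1); last by apply/funext => u; rewrite fctE.
  by apply: is_derive_eq; rewrite /GRing.scale /= mulr1 mulr_natl.
apply: (is_derive_eq (is_deriveB (is_deriveZ N.+1%:R IH) (is_deriveM dX (dexp t)))).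
rewrite /GRing.scale /=. ring.
Qed.

Lemma Gamma_nat (R : realType) (N : nat) : Gamma (N.+1%:R : R) = N`!%:R.
Proof.
rewrite /Gamma.
have F0 : forall N, gamma_primitive N (0 : R) = - N`!%:R.
  elim => [|M IH] /=; first by rewrite oppr0 expR0 fact0.
  by rewrite IH expr0n /= mul0r subr0 mulrN -natrM -factS.
have cf : continuous (fun t : R => t ^+ N * expR (- t)).
  move=> t; apply: cvgM; first exact: exprn_continuous.
  by apply: continuous_comp; [exact: opp_continuous | exact: continuous_expR].
have cF : continuous (@gamma_primitive R N).
  move=> t. apply/differentiable_continuous/derivable1_diffP.
  by case: (is_derive_gamma_primitive N t).
have mono (f : R -> R) (D : set R) : continuous f -> {within D, continuous f}.
  exact: continuous_subspaceT.
have key : \int[lebesgue_measure]_(t in `[0, +oo[) (t ^+ N * expR (- t)) = N`!%:R :> R.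
  rewrite (Rintegral_ge0_continuous_FTC2y (F := gamma_primitive N) (l := 0)).
  - by rewrite F0 opprK add0r.
  - by move=> x x0; rewrite mulr_ge0 ?exprn_ge0 ?expR_ge0.
  - exact: mono.
  - exact: cvgr_gamma_primitive.
  - by move=> x _; case: (is_derive_gamma_primitive N x).
  - by apply/cvg_at_right_filter; exact: cF.
  - by move=> x _; rewrite derive1E; case: (is_derive_gamma_primitive N x).
rewrite -key.
(* The fundamental theorem of calculus applies on the closed half-line. The open one in [Gamma]
   differs by a null point, and on it the real power is a natural power. *)
transitivity (\int[lebesgue_measure]_(t in `]0, +oo[) (t ^+ N * expR (- t)) : R).
  apply: eq_Rintegral => t; rewrite inE /= in_itv /= andbT => t0.
  by rewrite -natr1 addrK powR_mulrn // ltW.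
rewrite /Rintegral integral_itv_obnd_cbnd //; apply/measurable_realfun.measurable_EFinP.
apply: measurable_funTS.
exact: measurable_realfun.continuous_measurable_fun.
Qed.

(** * A submultiplicative norm *)

Section CliffordNorm.
Variables (R : realType) (n : nat).
Implicit Types (A B : {set 'I_n}) (a b : clifford R n).

(** The l1 norm in the basis of blades. A product of two blades is a blade up to sign, so this norm
    is submultiplicative with constant 1, and powers can be estimated without extra factors. *)
Definition cnorm a : R := \sum_A `|coef a A|.

Lemma cnorm_ge0 a : 0 <= cnorm a.
Proof. by apply: sumr_ge0 => A _; exact: normr_ge0. Qed.

Lemma cnormD a b : cnorm (a + b) <= cnorm a + cnorm b.
Proof.
by rewrite /cnorm -big_split; apply: ler_sum => A _; rewrite Defs.coefD ler_normD.
Qed.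

Lemma cnormZ (k : R) a : cnorm (k *: a) = `|k| * cnorm a.
Proof.
by rewrite /cnorm mulr_sumr; apply: eq_bigr => A _; rewrite Defs.coefZ normrM.
Qed.

Lemma cnorm0 : cnorm 0 = 0.
Proof. by rewrite -(scale0r (0 : clifford R n)) cnormZ normr0 mul0r. Qed.

Lemma cnormN a : cnorm (- a) = cnorm a.
Proof. by rewrite -scaleN1r cnormZ normrN1 mul1r. Qed.

Lemma cnorm_sum I (r : seq I) (P : pred I) (F : I -> clifford R n) :
  cnorm (\sum_(i <- r | P i) F i) <= \sum_(i <- r | P i) cnorm (F i).
Proof.
elim/big_rec2: _ => [|i x y _ h]; first by rewrite cnorm0.
by apply: le_trans (cnormD _ _) _; rewrite lerD2l.
Qed.

Lemma norm_coef_le_cnorm a A : `|coef a A| <= cnorm a.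
Proof.
by rewrite /cnorm (bigD1 A) //= lerDl; apply: sumr_ge0 => B _; exact: normr_ge0.
Qed.

Lemma cnorm_blade A : cnorm (blade R A) = 1.
Proof.
rewrite /cnorm (bigD1 A) //= big1 => [|B BA].
  by rewrite coef_blade eqxx normr1 addr0.
by rewrite coef_blade eq_sym (negbTE BA) normr0.
Qed.

Lemma norm_csign A B : `|csign R A B| = 1.
Proof.
rewrite normr_prod big1 // => i _; rewrite normr_prod big1 // => j _.
by rewrite normrX normrN1 expr1n.
Qed.

Lemma cnormM a b : cnorm (a * b) <= cnorm a * cnorm b.
Proof.
apply: le_trans (cnorm_sum _ _ _) _; rewrite {2}/cnorm mulr_suml.
apply: ler_sum => A _; apply: le_trans (cnorm_sum _ _ _) _.
rewrite mulr_sumr; apply: ler_sum => B _.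
by rewrite cnormZ cnorm_blade mulr1 !normrM norm_csign mul1r.
Qed.

Lemma cnorm1 : cnorm 1 = 1.
Proof. exact: cnorm_blade. Qed.

(** Transfers to [cnorm] the bounds that convergence provides for the sup norm of row vectors. *)
Lemma cnorm_le_normr a : cnorm a <= #|{set 'I_n}|%:R * `|a|.
Proof.
rewrite mulr_natl -sumr_const; apply: ler_sum => A _.
rewrite [leRHS]/Num.Def.normr/= mx_normrE.
exact: (le_bigmax _ (fun ij => `|a ij.1 ij.2|) (0, enum_rank A)).
Qed.

Lemma cvg_coef (T : Type) (F : set_system T) (f : T -> clifford R n) a A :
  Filter F -> f @ F --> a -> coef (f x) A @[x --> F] --> coef a A.
Proof.
move=> FF fa; have := @coord_continuous R 1 _ 0 (enum_rank A) a.
exact: (@cvg_comp _ _ _ f (fun b => coef b A) F (nbhs a) (nbhs (coef a A)) fa).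
Qed.

Lemma cvg_bigsum (W : normedModType R) (T I : Type) (F : set_system T)
    (r : seq I) (f : I -> T -> W) (l : I -> W) :
  Filter F -> (forall i, f i @ F --> l i) ->
  \sum_(i <- r) f i x @[x --> F] --> \sum_(i <- r) l i.
Proof.
move=> FF fl; elim: r => [|i r IH].
  by rewrite big_nil; under eq_cvg do rewrite big_nil; exact: cvg_cst.
by rewrite big_cons; under eq_cvg do rewrite big_cons; exact: cvgD.
Qed.

Lemma cvg_cmul (T : Type) (F : set_system T) (f g : T -> clifford R n) a b :
  Filter F -> f @ F --> a -> g @ F --> b -> f x * g x @[x --> F] --> a * b.
Proof.
move=> FF fa gb.
apply: cvg_bigsum => A; apply: cvg_bigsum => B.
apply: cvgZ; last exact: cvg_cst.
apply: cvgM; last exact: cvg_coef.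
by apply: cvgM; [exact: cvg_cst | exact: cvg_coef].
Qed.

Lemma cvg_cmull c (T : Type) (F : set_system T) (f : T -> clifford R n) a :
  Filter F -> f @ F --> a -> c * f x @[x --> F] --> c * a.
Proof. by move=> FF; apply: cvg_cmul; exact: cvg_cst. Qed.

End CliffordNorm.

(** * Rules of differentiation *)

(** Derivability in one direction does not imply continuity, but it gives the limit along the line
    through [x], which is all that the product rule requires. *)
Lemma derivable_cvg_shift (R : realType) (V W : normedModType R) (g : V -> W) (x v : V) :
  derivable g x v -> g (h *: v + x) @[h --> (0 : R)^'] --> g x.
Proof.
move=> /cvg_ex [l gl].
have h0 : (h : R) @[h --> (0 : R)^'] --> (0 : R) by exact: nbhs_dnbhs.
have : (fun h : R => h *: (h^-1 *: (g (h *: v + x) - g x)) + g x) @ 0^' --> g x.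
  rewrite -[X in _ --> X]add0r -[X in _ --> X + _](scale0r l).
  by apply: cvgD; [exact: cvgZ | exact: cvg_cst].
apply: cvg_trans; apply: near_eq_cvg.
near=> h; rewrite /= scalerA divff ?scale1r ?subrK //.
by near: h; exact: nbhs_dnbhs_neq.
Unshelve. all: by end_near. Qed.

Lemma derive_line (R : realType) (V W : normedModType R) (f : V -> W) (x v : V) :
  'D_v f x = 'D_1 (fun h : R => f (h *: v + x)) 0.
Proof.
rewrite /derive; set g1 := fun h => h^-1 *: _; set g2 := fun h => h^-1 *: _.
suff -> : g1 = g2 by [].
by rewrite funeqE /g1 /g2 => h /=; rewrite addr0 scale0r add0r [_%:A]mulr1.
Qed.

Section CliffordDerive.
Variables (R : realType) (n : nat) (V : normedModType R).
Implicit Types (f g : V -> clifford R n) (x v : V) (c : clifford R n).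

Lemma is_derive_cmul f g x v df dg :
  is_derive x v f df -> is_derive x v g dg ->
  is_derive x v (fun y => f y * g y) (df * g x + f x * dg).
Proof.
move=> [fd <-] [gd <-].
have key : (fun h : R => h^-1 *: (((fun y => f y * g y) \o shift x) (h *: v)
    - f x * g x)) @ 0^' --> 'D_v f x * g x + f x * 'D_v g x.
  rewrite (_ : (fun _ => _) = fun h : R =>
     (h^-1 *: ((f \o shift x) (h *: v) - f x)) * g (h *: v + x) +
     f x * (h^-1 *: ((g \o shift x) (h *: v) - g x))); last first.
    apply/funext => h /=.
    by rewrite -scalerAl -scalerAr -scalerDr mulrBl mulrBr addrA subrK.
  apply: cvgD.
    by apply: cvg_cmul; [exact: fd | exact: derivable_cvg_shift].
  by apply: cvg_cmul; [exact: cvg_cst | exact: gd].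
by apply: DeriveDef; [apply/cvg_ex; eexists; exact: key | exact: cvg_lim].
Qed.

Lemma is_derive_cmull c f x v df :
  is_derive x v f df -> is_derive x v (fun y => c * f y) (c * df).
Proof.
move=> fd; have cd := is_derive_cst c x v.
by apply: (is_derive_eq (is_derive_cmul cd fd)); rewrite mul0r add0r.
Qed.

Lemma is_derive_cmulr c f x v df :
  is_derive x v f df -> is_derive x v (fun y => f y * c) (df * c).
Proof.
move=> fd; have cd := is_derive_cst c x v.
by apply: (is_derive_eq (is_derive_cmul fd cd)); rewrite mulr0 addr0.
Qed.

Lemma is_derive_bigsum (I : Type) (r : seq I) (F : I -> V -> clifford R n)
    (dF : I -> clifford R n) x v :
  (forall i, is_derive x v (F i) (dF i)) ->
  is_derive x v (fun y => \sum_(i <- r) F i y) (\sum_(i <- r) dF i).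
Proof.
move=> Fd; elim: r => [|i r IH].
  rewrite big_nil (_ : (fun _ => _) = cst 0); first exact: is_derive_cst.
  by apply/funext => y; rewrite big_nil.
rewrite big_cons (_ : (fun _ => _) = F i + (fun y => \sum_(j <- r) F j y)).
  exact: is_deriveD.
by apply/funext => y; rewrite big_cons.
Qed.

Lemma is_derive_linear (L : V -> clifford R n) x v :
  (forall (k : R) y z, L (k *: y + z) = k *: L y + L z) -> is_derive x v L (L v).
Proof.
move=> Llin.
have key : (fun h : R => h^-1 *: ((L \o shift x) (h *: v) - L x)) @ 0^' --> L v.
  have : (fun h : R => L v) @ 0^' --> L v by exact: cvg_cst.
  apply: cvg_trans; apply: near_eq_cvg.
  near=> h; rewrite /= Llin addrK scalerA mulVf ?scale1r //.
  by near: h; exact: nbhs_dnbhs_neq.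
by apply: DeriveDef; [apply/cvg_ex; eexists; exact: key | exact: cvg_lim].
Unshelve. all: by end_near. Qed.

Lemma is_derive_coef f x v df A :
  is_derive x v f df -> is_derive x v (fun y => coef (f y) A) (coef df A).
Proof.
move=> [fd <-].
have key : coef (h^-1 *: ((f \o shift x) (h *: v) - f x)) A @[h --> (0 : R)^'] -->
  coef ('D_v f x) A by apply: cvg_coef; exact: fd.
have key2 : (fun h : R => h^-1 *: (((fun y => coef (f y) A) \o shift x) (h *: v)
    - coef (f x) A)) @ 0^' --> coef ('D_v f x) A.
  move: key; apply: cvg_trans; apply: near_eq_cvg; near=> h.
  by rewrite Defs.coefZ Defs.coefD -scaleN1r Defs.coefZ mulN1r.
by apply: DeriveDef; [apply/cvg_ex; eexists; exact: key2 | exact: cvg_lim].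
Unshelve. all: by end_near. Qed.

(** Reduces derivatives to real-valued functions, where the mean value theorem is available. *)
Lemma is_derive_from_coef f x v df :
  (forall A, is_derive x v (fun y => coef (f y) A) (coef df A)) ->
  is_derive x v f df.
Proof.
move=> h.
rewrite (_ : f = fun y => \sum_(A : {set 'I_n}) coef (f y) A *: blade R A); last first.
  by apply/funext => y; exact: clifford_sum.
rewrite (clifford_sum df); apply: is_derive_bigsum => A.
have [hd hv] := h A.
have key : (fun k : R => k^-1 *: (((fun y => coef (f y) A *: blade R A) \o shift x)
   (k *: v) - coef (f x) A *: blade R A)) @ 0^' --> coef df A *: blade R A.
  rewrite -hv; under eq_cvg do rewrite /= -scalerBl scalerA.
  by apply: cvgZr_tmp; exact: hd.
by apply: DeriveDef; [apply/cvg_ex; eexists; exact: key | exact: cvg_lim].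
Qed.

Lemma differentiable_bigsum (I : Type) (r : seq I) (F : I -> V -> clifford R n) x :
  (forall i, differentiable (F i) x) ->
  differentiable (fun y => \sum_(i <- r) F i y) x.
Proof.
move=> Fd; elim: r => [|i r IH].
  rewrite (_ : (fun _ => _) = cst 0); first exact: differentiable_cst.
  by apply/funext => y; rewrite big_nil.
rewrite (_ : (fun _ => _) = F i + (fun y => \sum_(j <- r) F j y)).
  exact: differentiableD.
by apply/funext => y; rewrite big_cons.
Qed.

Lemma differentiable_coef f x A :
  differentiable f x -> differentiable (fun y => coef (f y) A) x.
Proof.
move=> fd; apply: (@differentiable_comp _ _ _ _ f (fun a => coef a A)) => //.
exact: (@differentiable_coord R 1 _ (f x) 0 (enum_rank A)).
Qed.

Lemma differentiable_cmul f g x :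
  differentiable f x -> differentiable g x ->
  differentiable (fun y => f y * g y) x.
Proof.
move=> fd gd.
apply: differentiable_bigsum => A; apply: differentiable_bigsum => B.
apply: (@differentiableZl _ _ _ (fun y => csign R A B * coef (f y) A * coef (g y) B)).
apply: differentiableM; last exact: differentiable_coef.
by apply: differentiableM; [exact: differentiable_cst | exact: differentiable_coef].
Qed.

End CliffordDerive.

(** * Termwise differentiation *)

Section DominatedSeries.
Variables (R : realType) (M : nat -> R).
Hypothesis Mcvg : cvgn (series M).

Lemma cvg_series_dominated (u : nat -> R) :
  (forall s, `|u s| <= M s) -> cvgn (series u).
Proof.
move=> uM; apply: (@normed_cvg R R^o).
apply: (@series_le_cvg _ _ M) => // s; first exact: normr_ge0.
by apply: le_trans (uM s); exact: normr_ge0.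
Qed.

Lemma series_tail_le (u : nat -> R) N : (forall s, `|u s| <= M s) ->
  `|limn (series u) - series u N| <= limn (series M) - series M N.
Proof.
move=> uM; have cu := cvg_series_dominated uM.
have c1 : (fun k => `|series u k - series u N|) @ \oo -->
    `|limn (series u) - series u N|.
  by apply: cvg_norm; apply: cvgB; [exact: cu | exact: cvg_cst].
rewrite -(cvg_lim _ c1) //; apply: limr_le; first by apply/cvg_ex; eexists; exact: c1.
near=> k.
have Nk : (N <= k)%N by near: k; exact: nbhs_infty_ge.
rewrite sub_series Nk /=; apply: le_trans (ler_norm_sum _ _ _) _.
apply: (@le_trans _ _ (series M k - series M N)).
  by rewrite sub_series Nk /=; apply: ler_sum => i _.
rewrite lerD2r; apply: nondecreasing_cvgn_le => //.
by apply: nondecreasing_series => i _ _; exact: le_trans (normr_ge0 _) (uM i).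
Unshelve. all: by end_near. Qed.

(** Three epsilons: a fixed partial sum passes to the limit, and both tails are bounded, uniformly
    in [t], by the tail of the majorant. *)
Lemma tannery (T : Type) (F : set_system T) (FF : ProperFilter F)
    (a : T -> nat -> R) (b : nat -> R) :
  (forall s, a t s @[t --> F] --> b s) ->
  (\forall t \near F, forall s, `|a t s| <= M s) ->
  limn (series (a t)) @[t --> F] --> limn (series b).
Proof.
move=> ab aM.
have bM s : `|b s| <= M s.
  have c1 : `|a t s| @[t --> F] --> `|b s| by apply: cvg_norm; exact: ab.
  rewrite -(cvg_lim _ c1) //; apply: limr_le; first by apply/cvg_ex; eexists; exact: c1.
  by near=> t; move: s c1; near: t; apply: filterS aM.
apply/cvgrPdist_lt => e e0.
have e3 : 0 < e / 3 by rewrite divr_gt0.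
have : \forall N \near \oo, limn (series M) - series M N < e / 3.
  move/cvgrPdist_lt: Mcvg => /(_ _ e3); apply: filterS => N.
  exact: le_lt_trans (ler_norm _).
case/filter_ex => N MN.
have sab : series (a t) N @[t --> F] --> series b N.
  exact: (@cvg_bigsum R R^o).
move/cvgrPdist_lt: sab => /(_ _ e3) sab.
near=> t.
have at_M : forall s, `|a t s| <= M s by near: t.
have h1 := series_tail_le N at_M; have h2 := series_tail_le N bM.
have h3 : `|series b N - series (a t) N| < e / 3 by near: t; exact: sab.
rewrite (_ : _ - _ = (limn (series b) - series b N) + (series b N - series (a t) N)
  - (limn (series (a t)) - series (a t) N)); last by ring.
apply: le_lt_trans (ler_normB _ _) _; apply: le_lt_trans (lerD (ler_normD _ _) (lexx _)) _.
lra.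
Unshelve. all: by end_near. Qed.

(** By the mean value theorem the bound on [f'] dominates the difference quotients, so [tannery]
    interchanges their limit with the sum; the bound on [f] makes the series itself converge. *)
Lemma is_derive_series (f f' : nat -> R -> R) (d : R) : 0 < d ->
  (forall s (t : R), `|t| < d -> is_derive t (1 : R) (f s) (f' s t)) ->
  (forall s t, `|t| < d -> `|f s t| <= M s /\ `|f' s t| <= M s) ->
  is_derive (0 : R) (1 : R) (fun t => limn (series (f^~ t)))
    (limn (series (f'^~ 0)) : R).
Proof.
move=> d0 fd fM.
have d0' : `|0 : R| < d by rewrite normr0.
have quot h s : `|h| < d -> h != 0 -> `|h^-1 * (f s h - f s 0)| <= M s.
  move=> hd hn0.
  have cf (a b : R) : `|a| < d -> `|b| < d -> {within `[a, b], continuous (f s)}.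
    move=> ad bd; apply: derivable_within_continuous => t; rewrite in_itv /= => /andP[at_ tb].
    suff td : `|t| < d by case: (fd s t td).
    move: ad bd; rewrite !ltr_norml => /andP[? ?] /andP[? ?]; apply/andP; split; lra.
  have step (a b : R) : `|a| < d -> `|b| < d -> a < b ->
      `|f s b - f s a| <= M s * `|b - a|.
    move=> ad bd ab.
    have lem t : t \in `]a, b[%R -> `|t| < d.
      rewrite in_itv /= => /andP[? ?].
      move: ad bd; rewrite !ltr_norml => /andP[? ?] /andP[? ?]; apply/andP; split; lra.
    have [c cab ->] := @MVT R (f s) (f' s) a b ab (fun t tab => fd s t (lem t tab)) (cf a b ad bd).
    rewrite normrM ler_wpM2r //; exact: (fM s c (lem c cab)).2.
  rewrite normrM normfV mulrC ler_pdivrMr ?normr_gt0 //.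
  have [h0|h0] := ltP 0 h.
    by have := step 0 h d0' hd h0; rewrite subr0.
  have h0' : h < 0 by rewrite lt_neqAle hn0.
  by have := step h 0 hd d0' h0'; rewrite sub0r normrN distrC.
have key : (fun h : R => h^-1 *: (((fun t => limn (series (f^~ t))) \o shift 0) (h *: 1)
    - limn (series (f^~ 0)))) @ 0^' --> limn (series (f'^~ 0)).
  have : limn (series (fun s => h^-1 * (f s h - f s 0))) @[h --> (0 : R)^'] -->
      limn (series (f'^~ 0)).
    apply: tannery.
      move=> s; have [hd hv] := fd s 0 d0'.
      move: hd; rewrite /derivable -/(derive (f s) 0 1) => hd.
      have : h^-1 *: ((f s \o shift 0) (h *: 1) - f s 0) @[h --> (0 : R)^'] --> f' s 0.
        by rewrite -hv; exact: hd.
      apply: cvg_trans; apply: near_eq_cvg; near=> h.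
      by rewrite /= addr0 [_%:A]mulr1.
    near=> h => s; apply: quot.
      by near: h; exact: dnbhs0_lt.
    by near: h; exact: nbhs_dnbhs_neq.
  apply: cvg_trans; apply: near_eq_cvg; near=> h.
  have hd : `|h| < d by near: h; exact: dnbhs0_lt.
  rewrite /= addr0 [_%:A]mulr1.
  have c1 : cvgn (series (f^~ h)) by apply: cvg_series_dominated => s; have [] := fM s h hd.
  have c0 : cvgn (series (f^~ 0)) by apply: cvg_series_dominated => s; have [] := fM s 0 d0'.
  have c2 := is_cvg_seriesB c1 c0.
  by rewrite -lim_seriesB // -[RHS]/(h^-1 *: _) -lim_seriesZ.
by apply: DeriveDef; [apply/cvg_ex; eexists; exact: key | exact: cvg_lim].
Unshelve. all: by end_near. Qed.

End DominatedSeries.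

Lemma is_derive_line (R : realType) (V W : normedModType R) (f : V -> W)
    (x v : V) (t : R) df :
  is_derive (t *: v + x) v f df -> is_derive t (1 : R) (fun u => f (u *: v + x)) df.
Proof.
have e : (fun h : R => h^-1 *: (((fun u => f (u *: v + x)) \o shift t) (h *: 1) - f (t *: v + x)))
  = (fun h : R => h^-1 *: ((f \o shift (t *: v + x)) (h *: v) - f (t *: v + x))).
  by apply/funext => h /=; rewrite [_%:A]mulr1 scalerDl addrA.
by move=> [fd fv]; apply: DeriveDef; rewrite ?/derivable ?/derive e.
Qed.

Section CliffordSeries.
Variables (R : realType) (n : nat).
Implicit Types (a b : nat -> clifford R n) (c : clifford R n).

Lemma cvg_cmull_series c a l :
  series a @ \oo --> l -> series (fun s => c * a s) @ \oo --> c * l.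
Proof.
move=> al; rewrite (_ : series _ = fun k => c * series a k).
  by apply: cvg_cmull; exact: al.
by apply/funext => k; rewrite /series /= mulr_sumr.
Qed.

Lemma cvg_coef_series a l A :
  series a @ \oo --> l -> series (fun s => coef (a s) A) @ \oo --> coef l A.
Proof.
move=> al; rewrite (_ : series _ = fun k => coef (series a k) A).
  by apply: cvg_coef; exact: al.
by apply/funext => k; rewrite /series /= /coef summxE.
Qed.

Lemma cvg_series_cnorm (M : nat -> R) a :
  cvgn (series M) -> (forall s, cnorm (a s) <= M s) -> cvgn (series a).
Proof.
move=> cM aM; apply/cvg_ex.
exists (\sum_(A : {set 'I_n}) limn (series (fun s => coef (a s) A)) *: blade R A).
rewrite (_ : series a = fun k => \sum_A series (fun s => coef (a s) A) k *: blade R A).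
  apply: cvg_bigsum => A; apply: cvgZr_tmp.
  apply: (cvg_series_dominated cM) => s.
  by apply: le_trans (aM s); exact: norm_coef_le_cnorm.
apply/funext => k; rewrite [LHS]clifford_sum; apply: eq_bigr => A _.
by rewrite /series /= /coef summxE.
Qed.

(** Restricted to the line through [x] in direction [v] and read coefficient by coefficient, this is
    the real case at t = 0. The identities hold for small t only, which is enough for a
    derivative. *)
Lemma is_derive_clifford_series (V : normedModType R) (M : nat -> R)
    (g g' : nat -> V -> clifford R n) (x v : V) (d : R) :
  cvgn (series M) -> 0 < d ->
  (forall s (t : R), `|t| < d ->
     [/\ is_derive (t *: v + x) v (g s) (g' s (t *: v + x)),
         cnorm (g s (t *: v + x)) <= M s
       & cnorm (g' s (t *: v + x)) <= M s]) ->
  is_derive x v (fun y => limn (series (g^~ y))) (limn (series (g'^~ x))).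
Proof.
move=> cM d0 gd.
have d0' : `|0 : R| < d by rewrite normr0.
have cg t : `|t| < d -> cvgn (series (g^~ (t *: v + x))).
  by move=> td; apply: (cvg_series_cnorm cM) => s; have [] := gd s t td.
have cg' : cvgn (series (g'^~ x)).
  apply: (cvg_series_cnorm cM) => s; have [_ _] := gd s 0 d0'.
  by rewrite scale0r add0r.
have cge t A : `|t| < d ->
    limn (series (fun s => coef (g s (t *: v + x)) A)) =
    coef (limn (series (g^~ (t *: v + x)))) A.
  by move=> td; apply: cvg_lim => //; apply: cvg_coef_series; exact: cg.
apply: is_derive_from_coef => A.
have D := is_derive_series (M := M)
   (f := fun s t => coef (g s (t *: v + x)) A)
   (f' := fun s t => coef (g' s (t *: v + x)) A) cM d0.
have {}D : is_derive (0 : R) (1 : R)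
    (fun t => limn (series (fun s => coef (g s (t *: v + x)) A)))
    (limn (series (fun s => coef (g' s (0 *: v + x)) A)) : R).
  apply: D => s t td; have [gdt gM gM'] := gd s t td; last first.
    by split; [apply: le_trans gM | apply: le_trans gM']; exact: norm_coef_le_cnorm.
  exact: (is_derive_line (is_derive_coef A gdt)).
rewrite scale0r add0r in D.
have [D1 D2] := D.
rewrite -[coef _ A](cvg_lim _ (cvg_coef_series (A := A) cg')) // -D2.
apply: DeriveDef; last first.
  rewrite derive_line; apply: near_eq_derive; near=> t.
  by apply/esym/cge; near: t; exact: (@nbhs0_lt R R^o).
apply/derivable1P; apply: near_eq_derivable D1; near=> t.
by apply: cge; near: t; exact: (@nbhs0_lt R R^o).
Unshelve. all: by end_near. Qed.

End CliffordSeries.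

(** * Smooth functions *)

Section SmoothFunctions.
Variables (R : realType) (n : nat).
Local Notation pt := 'rV[R]_n.+1.
Implicit Types (f g : pt -> clifford R n) (x e : pt) (c : clifford R n).

Definition dird e f : pt -> clifford R n := fun x => 'D_e f x.

(** Only directional derivatives are iterated, with no continuity required: the product rules below
    need no more, and they are applied to polynomials on the whole space. *)
Fixpoint dird_times k f : Prop :=
  if k is k'.+1 then (forall x e, derivable f x e) /\ forall e, dird_times k' (dird e f)
  else True.

Definition smooth f := forall k, dird_times k f.

Lemma smooth_is_derive f x e : smooth f -> is_derive x e f (dird e f x).
Proof. by move=> /(_ 1%N) [fd _]; apply: DeriveDef. Qed.

Lemma smooth_dird f e : smooth f -> smooth (dird e f).
Proof. by move=> sf k; have [_ h] := sf k.+1; exact: h. Qed.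
Lemma dird_eq f f' e : (forall x, is_derive x e f (f' x)) -> dird e f = f'.
Proof. by move=> h; apply/funext => x; case: (h x). Qed.

Lemma dirdD f g e : smooth f -> smooth g ->
  dird e (fun x => f x + g x) = fun x => dird e f x + dird e g x.
Proof.
move=> sf sg; apply: dird_eq => x.
exact: (is_deriveD (smooth_is_derive x e sf) (smooth_is_derive x e sg)).
Qed.

Lemma dirdM f g e : smooth f -> smooth g ->
  dird e (fun x => f x * g x) = fun x => dird e f x * g x + f x * dird e g x.
Proof.
move=> sf sg; apply: dird_eq => x.
exact: (is_derive_cmul (smooth_is_derive x e sf) (smooth_is_derive x e sg)).
Qed.

Lemma dirdZ f (k : R) e : smooth f ->
  dird e (fun x => k *: f x) = fun x => k *: dird e f x.
Proof.
by move=> sf; apply: dird_eq => x; exact: (is_deriveZ k (smooth_is_derive x e sf)).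
Qed.

Lemma dird_cst c e : dird e (fun=> c) = fun=> 0.
Proof. by apply: dird_eq => x; exact: is_derive_cst. Qed.

Lemma smooth_cst c : smooth (fun=> c).
Proof.
move=> k; elim: k c => [//|k IH] c; split=> [x e|e]; first exact: derivable_cst.
by rewrite dird_cst; exact: IH.
Qed.

Lemma dird_timesD k f g :
  dird_times k f -> dird_times k g -> dird_times k (fun x => f x + g x).
Proof.
elim: k f g => [//|k IH] f g [fd fD] [gd gD]; split=> [x e|e].
  by case: (is_deriveD (derivableP (fd x e)) (derivableP (gd x e))).
rewrite (_ : dird e _ = fun x => dird e f x + dird e g x).
  by apply: IH; [exact: fD | exact: gD].
apply: dird_eq => x; exact: (is_deriveD (derivableP (fd x e)) (derivableP (gd x e))).
Qed.

Lemma smoothD f g : smooth f -> smooth g -> smooth (fun x => f x + g x).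
Proof. by move=> sf sg k; apply: dird_timesD; [exact: sf | exact: sg]. Qed.

Lemma smoothZ f (k : R) : smooth f -> smooth (fun x => k *: f x).
Proof.
move=> sf m; elim: m f sf => [//|m IH] f sf; split=> [x e|e].
  by case: (is_deriveZ k (smooth_is_derive x e sf)).
by rewrite dirdZ //; apply: IH; exact: smooth_dird.
Qed.

Lemma smoothM f g : smooth f -> smooth g -> smooth (fun x => f x * g x).
Proof.
move=> sf sg k; elim: k f g sf sg => [//|k IH] f g sf sg; split=> [x e|e].
  by case: (is_derive_cmul (smooth_is_derive x e sf) (smooth_is_derive x e sg)).
rewrite dirdM //.
by apply: dird_timesD; apply: IH => //; exact: smooth_dird.
Qed.

Lemma smoothX f k : smooth f -> smooth (fun x => f x ^+ k).
Proof.
move=> sf; elim: k => [|k IH].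
  by rewrite (_ : (fun _ => _) = fun=> 1) ?funeqE //; exact: smooth_cst.
rewrite (_ : (fun _ => _) = fun x => f x * f x ^+ k); first exact: smoothM.
by apply/funext => x; rewrite exprS.
Qed.

Lemma smooth_sum I (r : seq I) (F : I -> pt -> clifford R n) :
  (forall i, smooth (F i)) -> smooth (fun x => \sum_(i <- r) F i x).
Proof.
move=> sF; elim: r => [|i r IH].
  by under [fun _ => _]funext do rewrite big_nil; exact: smooth_cst.
by under [fun _ => _]funext do rewrite big_cons; exact: smoothD.
Qed.

Lemma dird_sum I (r : seq I) (F : I -> pt -> clifford R n) e :
  (forall i, smooth (F i)) ->
  dird e (fun x => \sum_(i <- r) F i x) = fun x => \sum_(i <- r) dird e (F i) x.
Proof.
move=> sF; apply: dird_eq => x; apply: is_derive_bigsum => i.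
exact: smooth_is_derive.
Qed.

Lemma dird_linear (L : pt -> clifford R n) e :
  (forall (k : R) y z, L (k *: y + z) = k *: L y + L z) -> dird e L = fun=> L e.
Proof. by move=> Llin; apply: dird_eq => x; exact: is_derive_linear. Qed.

Lemma smooth_linear (L : pt -> clifford R n) :
  (forall (k : R) y z, L (k *: y + z) = k *: L y + L z) -> smooth L.
Proof.
move=> Llin [//|k]; split=> [x e|e]; first by case: (is_derive_linear x e Llin).
by rewrite dird_linear //; exact: smooth_cst.
Qed.

Lemma ve_linear (k : R) (y z : pt) : ve (k *: y + z) = k *: ve y + ve z.
Proof.
rewrite /ve scaler_sumr -big_split; apply: eq_bigr => l _ /=.
by rewrite !mxE scalerDl scalerA.
Qed.

Lemma para_linear (k : R) (y z : pt) : para (k *: y + z) = k *: para y + para z.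
Proof. by rewrite /para /re !mxE ve_linear scalerDl -scalerA scalerDr addrACA. Qed.

Lemma para_conj_linear (k : R) (y z : pt) :
  para_conj (k *: y + z) = k *: para_conj y + para_conj z.
Proof.
by rewrite /para_conj /re !mxE ve_linear scalerDl -scalerA scalerBr opprD addrACA.
Qed.

Lemma smooth_para : smooth (@para R n). Proof. exact: (smooth_linear para_linear). Qed.

Lemma smooth_para_conj : smooth (@para_conj R n).
Proof. exact: (smooth_linear para_conj_linear). Qed.

Lemma dird_para e : dird e (@para R n) = fun=> para e.
Proof. exact: (dird_linear e para_linear). Qed.

Lemma dird_para_conj e : dird e (@para_conj R n) = fun=> para_conj e.
Proof. exact: (dird_linear e para_conj_linear). Qed.

(** Adding the double sum to itself with its indices exchanged cancels the off-diagonal terms by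
    anticommutation; the factor 2 is removed at the end. *)
Lemma ve_sqr x : ve x * ve x = - (\sum_(l < n) x 0 (lift ord0 l) ^+ 2)%:A.
Proof.
set w := fun l : 'I_n => x 0 (lift ord0 l).
have S : ve x * ve x = \sum_l \sum_k (w l * w k) *: (gen R l * gen R k).
  rewrite /ve mulr_suml; apply: eq_bigr => l _; rewrite mulr_sumr.
  by apply: eq_bigr => k _; rewrite -scalerAl -scalerAr scalerA.
have S2 : ve x * ve x + ve x * ve x = 2 *: - (\sum_(l < n) w l ^+ 2)%:A.
  rewrite {1}S S [X in X + _]exchange_big -big_split /= scaler_suml -sumrN scaler_sumr.
  apply: eq_bigr => l _; rewrite -big_split /= (bigD1 l) //= big1 => [|k kl].
    by rewrite gen_sqr addr0 !scalerN expr2 -[2]/(1 + 1) scalerDl scale1r opprD.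
  by rewrite [w k * w l]mulrC -scalerDr gen_anticomm ?scaler0 // eq_sym.
apply: (@scalerI R _ 2); first by rewrite pnatr_eq0.
by rewrite -S2 -[2]/(1 + 1) scalerDl scale1r.
Qed.

End SmoothFunctions.

(** * Product rules for the Laplacian *)

Section Laplacian.
Variables (R : realType) (n : nat).
Local Notation pt := 'rV[R]_n.+1.
Local Notation basis i := (delta_mx 0 i : pt).
Implicit Types (f g : pt -> clifford R n) (x e : pt).

Definition dot x e : R := \sum_i x 0 i * e 0 i.

Lemma dot_basis x i : dot x (basis i) = x 0 i.
Proof.
rewrite /dot (bigD1 i) //= big1 => [|j ji]; rewrite mxE eqxx /=.
  by rewrite eqxx mulr1 addr0.
by rewrite (negbTE ji) mulr0.
Qed.

Lemma re_ve_comm x : (re x)%:A * ve x = ve x * (re x)%:A.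
Proof. by rewrite -scalerAl -scalerAr mul1r mulr1. Qed.

Lemma para_conjC x : para_conj x * para x = para x * para_conj x.
Proof.
rewrite /para /para_conj mulrDl [RHS]mulrDl !mulrDr !mulrN !mulNr -re_ve_comm.
by rewrite !addrA addrK subrK.
Qed.

Lemma para_mul_conj x : para x * para_conj x = (dot x x)%:A.
Proof.
rewrite /para /para_conj mulrDl !mulrBr -re_ve_comm addrA subrK ve_sqr opprK.
rewrite -scalerAl mul1r scalerA -expr2 -scalerDl /dot big_ord_recl.
by congr (_ + _)%:A; apply: eq_bigr => l _; rewrite expr2.
Qed.

Lemma paraD x e : para (x + e) = para x + para e.
Proof. by have := para_linear 1 x e; rewrite !scale1r. Qed.

Lemma para_conjD x e : para_conj (x + e) = para_conj x + para_conj e.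
Proof. by have := para_conj_linear 1 x e; rewrite !scale1r. Qed.

(** Polarization of [para_mul_conj]; it computes the derivative of |x|^2 in direction [e]. *)
Lemma para_polar x e :
  para e * para_conj x + para x * para_conj e = (2 * dot x e)%:A.
Proof.
have := para_mul_conj (x + e); rewrite paraD para_conjD mulrDl
  (mulrDr (para x) (para_conj x)) (mulrDr (para e) (para_conj x)).
rewrite !para_mul_conj => h.
have -> : 2 * dot x e = dot (x + e) (x + e) - dot x x - dot e e.
  rewrite /dot mulr_sumr -!sumrB; apply: eq_bigr => i _; rewrite !mxE; ring.
rewrite !scalerBl -h [X in X - _ - _]addrA [RHS]addrAC addrK.
by rewrite -[X in X - _]addrA [RHS]addrAC subrr add0r addrC.
Qed.

Lemma laplacianE f x : laplacian f x = \sum_i dird (basis i) (dird (basis i) f) x.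
Proof. by []. Qed.

Lemma laplacianD f g x : smooth f -> smooth g ->
  laplacian (fun x => f x + g x) x = laplacian f x + laplacian g x.
Proof.
move=> sf sg; rewrite !laplacianE -big_split; apply: eq_bigr => i _ /=.
by rewrite !dirdD //; exact: smooth_dird.
Qed.

Lemma laplacianZ f (k : R) x : smooth f ->
  laplacian (fun x => k *: f x) x = k *: laplacian f x.
Proof.
move=> sf; rewrite !laplacianE scaler_sumr; apply: eq_bigr => i _ /=.
by rewrite !dirdZ //; exact: smooth_dird.
Qed.

Lemma laplacianM f g x : smooth f -> smooth g ->
  laplacian (fun x => f x * g x) x =
  laplacian f x * g x + 2 *: (\sum_i dird (basis i) f x * dird (basis i) g x) +
  f x * laplacian g x.
Proof.
move=> sf sg; rewrite !laplacianE mulr_suml scaler_sumr mulr_sumr -!big_split.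
apply: eq_bigr => i _ /=; rewrite dirdM // dirdD ?dirdM //; do ?exact: smooth_dird.
  by rewrite -[2]/(1 + 1) scalerDl scale1r !addrA.
by apply: smoothM => //; exact: smooth_dird.
by apply: smoothM => //; exact: smooth_dird.
Qed.

(** The scalar 2 x_0, kept inside the Clifford algebra. Together with [norm_fun] it gives the
    coefficients of x^2 - 2 x_0 x + |x|^2 = 0, hence those of |1 - x|^2. *)
Definition trace_fun x : clifford R n := para x + para_conj x.

Lemma trace_fun_linear (k : R) (y z : pt) :
  trace_fun (k *: y + z) = k *: trace_fun y + trace_fun z.
Proof.
rewrite /trace_fun para_linear para_conj_linear (scalerDr k (para y)).
by rewrite (addrACA (k *: para y)).
Qed.

Lemma trace_funE x : trace_fun x = (2 * re x)%:A.
Proof. by rewrite /trace_fun /para /para_conj addrACA subrr addr0 mulr_natl mulr2n scalerDl. Qed.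

Lemma laplacian_traceM f x : smooth f ->
  laplacian (fun x => trace_fun x * f x) x =
  trace_fun x * laplacian f x + 4 *: dird (basis 0) f x.
Proof.
move=> sf; have st : smooth trace_fun by exact: (smooth_linear trace_fun_linear).
rewrite laplacianM // laplacianE big1 ?mul0r ?add0r => [|i _]; last first.
  by rewrite (dird_linear _ trace_fun_linear) dird_cst.
rewrite addrC; congr (_ + _); rewrite (bigD1 0) //= big1 => [|i i0].
  rewrite (dird_linear _ trace_fun_linear) trace_funE /re mxE eqxx /=.
  by rewrite -scalerAl mul1r addr0 scalerA; congr (_ *: _); ring.
rewrite (dird_linear _ trace_fun_linear) trace_funE /re mxE eqxx /=.
by rewrite eq_sym (negbTE i0) mulr0 scale0r mul0r.
Qed.

Definition euler f x : clifford R n := \sum_i x 0 i *: dird (basis i) f x.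

Definition norm_fun x : clifford R n := para x * para_conj x.

Lemma dird_norm_fun e : dird e norm_fun = fun x => (2 * dot x e)%:A.
Proof.
apply/funext => x; rewrite dirdM; first by rewrite dird_para dird_para_conj para_polar.
  exact: smooth_para. exact: smooth_para_conj.
Qed.

(** The gradient of |x|^2 is 2x, so the cross term of the product rule is four times the Euler
    operator; the last constant is the Laplacian of |x|^2 in dimension n + 1. *)
Lemma laplacian_normM f x : smooth f ->
  laplacian (fun x => norm_fun x * f x) x =
  norm_fun x * laplacian f x + 4 *: euler f x + (2 * n.+1%:R) *: f x.
Proof.
move=> sf; have st : smooth norm_fun.
  by apply: smoothM; [exact: smooth_para | exact: smooth_para_conj].
rewrite laplacianM // laplacianE addrC [_ * f x + _]addrC addrA.
congr (_ + _ + _).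
  rewrite /euler !scaler_sumr; apply: eq_bigr => i _.
  rewrite dird_norm_fun dot_basis -scalerAl mul1r !scalerA; congr (_ *: _); ring.
rewrite (eq_bigr (fun=> (2 : R)%:A)) => [|i _].
  by rewrite sumr_const card_ord scalerMnl -mulr_natr -scalerAl mul1r.
rewrite dird_norm_fun.
have dl (k : R) (y z : pt) : (2 * dot (k *: y + z) (basis i))%:A =
   k *: (2 * dot y (basis i))%:A + (2 * dot z (basis i))%:A :> clifford R n.
  by rewrite !dot_basis !mxE scalerA -scalerDl; congr (_ *: _); ring.
by rewrite (dird_linear _ dl) dot_basis mxE !eqxx mulr1.
Qed.

Lemma eulerM f g x : smooth f -> smooth g ->
  euler (fun x => f x * g x) x = euler f x * g x + f x * euler g x.
Proof.
move=> sf sg; rewrite /euler mulr_suml mulr_sumr -big_split; apply: eq_bigr => i _.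
by rewrite dirdM // scalerDr -scalerAl -scalerAr.
Qed.

Lemma eulerZ f (k : R) x : smooth f ->
  euler (fun x => k *: f x) x = k *: euler f x.
Proof.
move=> sf; rewrite /euler scaler_sumr; apply: eq_bigr => i _.
by rewrite dirdZ // !scalerA mulrC.
Qed.

Lemma euler_sum I (r : seq I) (F : I -> pt -> clifford R n) x :
  (forall i, smooth (F i)) ->
  euler (fun x => \sum_(i <- r) F i x) x = \sum_(i <- r) euler (F i) x.
Proof.
move=> sF; rewrite /euler exchange_big; apply: eq_bigr => i _ /=.
by rewrite dird_sum // scaler_sumr.
Qed.

Lemma euler_linear (L : pt -> clifford R n) x :
  (forall (k : R) y z, L (k *: y + z) = k *: L y + L z) -> euler L x = L x.
Proof.
move=> Llin.
have L0 : L 0 = 0.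
  by have := Llin (-1) 0 0; rewrite scaler0 addr0 scaleN1r addNr.
have Lsum (r : seq 'I_n.+1) (F : 'I_n.+1 -> R) :
    L (\sum_(i <- r) F i *: basis i) = \sum_(i <- r) F i *: L (basis i).
  by elim: r => [|i r IH]; rewrite ?big_nil ?L0 // !big_cons Llin IH.
rewrite [in RHS](row_sum_delta x) Lsum.
by apply: eq_bigr => i _; rewrite dird_linear.
Qed.

Lemma eulerX f k x : smooth f -> euler f x = f x ->
  euler (fun x => f x ^+ k) x = k%:R *: f x ^+ k.
Proof.
move=> sf ef; elim: k => [|k IH].
  rewrite scale0r (_ : (fun _ => _) = fun=> 1) ?funeqE // /euler big1 // => i _.
  by rewrite dird_cst scaler0.
rewrite (_ : (fun _ => _) = fun x => f x * f x ^+ k); last first.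
  by apply/funext => y; rewrite exprS.
rewrite eulerM //; last exact: smoothX.
by rewrite ef IH -scalerAr -exprS -natr1 scalerDl scale1r addrC.
Qed.

End Laplacian.

(** * The polynomials H_(j,s) *)

Section RisingCoefficients.
Variable R : realType.
Implicit Type a : R.

(** The coefficient of z^i in (1 - z)^(-a). *)
Definition rising_coef a i : R := pochhammer a i / i`!%:R.

Lemma pochhammer0 a : pochhammer a 0 = 1.
Proof. by rewrite /pochhammer big_ord0. Qed.

Lemma pochhammerS a i : pochhammer a i.+1 = pochhammer a i * (a + i%:R).
Proof. by rewrite /pochhammer big_ord_recr. Qed.

Lemma pochhammerSl a i : pochhammer a i.+1 = a * pochhammer (a + 1) i.
Proof.
rewrite /pochhammer big_ord_recl addr0; congr (_ * _); apply: eq_bigr => j _.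
by rewrite -addrA nat1r.
Qed.

Lemma factr_neq0 i : i`!%:R != 0 :> R.
Proof. by rewrite pnatr_eq0 -lt0n fact_gt0. Qed.

Lemma rising_coef0 a : rising_coef a 0 = 1.
Proof. by rewrite /rising_coef pochhammer0 fact0 divr1. Qed.

Lemma rising_coefS a i : i.+1%:R * rising_coef a i.+1 = (a + i%:R) * rising_coef a i.
Proof.
have := factr_neq0 i; have : i.+1%:R != 0 :> R by rewrite pnatr_eq0.
rewrite /rising_coef pochhammerS factS natrM => h1 h2; field; rewrite h2.
by rewrite -natr1 in h1; rewrite addrC.
Qed.

(** Compares coefficients in (1 - z) (1 - z)^(-a) = (1 - z)^(-(a - 1)). *)
Lemma rising_coef_pascal a i :
  rising_coef a i.+1 = rising_coef a i + rising_coef (a - 1) i.+1.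
Proof.
have i0 : i.+1%:R != 0 :> R by rewrite pnatr_eq0.
apply: (mulfI i0); rewrite mulrDr rising_coefS.
rewrite {3}/rising_coef pochhammerSl subrK factS natrM.
have -> : i.+1%:R * ((a - 1) * pochhammer a i / (i.+1%:R * i`!%:R)) =
   (a - 1) * rising_coef a i.
  by rewrite /rising_coef; have := factr_neq0 i => h2; rewrite -natr1 in i0 *; field; rewrite h2.
by rewrite -mulrDl -natr1; congr (_ * _); ring.
Qed.

Lemma rising_coef_0S i : rising_coef 0 i.+1 = 0.
Proof. by rewrite /rising_coef pochhammerSl !mul0r. Qed.

(** The ratio of consecutive coefficients is (a + i) / (i + 1), of modulus at most 1 + b. *)
Lemma norm_rising_coef a b i : `|a| <= b -> `|rising_coef a i| <= (1 + b) ^+ i.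
Proof.
move=> ab; elim: i => [|i IH]; first by rewrite rising_coef0 normr1 expr0.
have i0 : 0 < i.+1%:R :> R by rewrite ltr0n.
rewrite -(ler_pM2l i0) -{1}(ger0_norm (ltW i0)) -normrM rising_coefS normrM exprS mulrA.
have b0 : 0 <= b by apply: le_trans ab.
apply: ler_pM => //; apply: le_trans (ler_normD _ _) _.
rewrite normr_nat -natr1 mulrDr mulr1 mulrDl mul1r.
have : 0 <= i%:R * b by rewrite mulr_ge0.
lra.
Qed.

End RisingCoefficients.

Section RisingPolynomials.
Variables (R : realType) (n : nat).
Local Notation pt := 'rV[R]_n.+1.
Local Notation basis i := (delta_mx 0 i : pt).
Implicit Types (a b : R) (x e : pt).

(** The part of degree s of (1 - x)^(-a) (1 - conj x)^(-b). The recurrences [rising_poly_recl] and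
    [rising_poly_recr] express multiplication by 1 - x and by 1 - conj x. *)
Definition rising_poly a b s x : clifford R n :=
  \sum_(i < s.+1) (rising_coef a (s - i) * rising_coef b i) *:
    (para x ^+ (s - i) * para_conj x ^+ i).

Lemma rising_poly0 a b x : rising_poly a b 0 x = 1.
Proof. by rewrite /rising_poly big_ord1 !rising_coef0 !expr0 !mulr1 scale1r. Qed.

Lemma rising_poly_recl a b s x :
  rising_poly a b s.+1 x = para x * rising_poly a b s x + rising_poly (a - 1) b s.+1 x.
Proof.
rewrite /rising_poly big_ord_recr [X in _ = _ + X]big_ord_recr /= addrA.
rewrite subnn !rising_coef0 mulr_sumr -big_split /=; congr (_ + _).
apply: eq_bigr => i _; have is_ : (i <= s)%N by rewrite -ltnS.
rewrite subSn // rising_coef_pascal mulrDl scalerDl -(scalerAr _ (para x)).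
by rewrite exprS (mulrA (para x)).
Qed.

Lemma rising_poly_recr a b s x :
  rising_poly a b s.+1 x =
  para_conj x * rising_poly a b s x + rising_poly a (b - 1) s.+1 x.
Proof.
rewrite /rising_poly big_ord_recl [X in _ = _ + X]big_ord_recl /= addrCA; congr (_ + _).
  by rewrite !rising_coef0.
rewrite mulr_sumr -big_split /=; apply: eq_bigr => i _.
rewrite /bump /= add1n subSS rising_coef_pascal mulrDr scalerDl.
rewrite -(scalerAr _ (para_conj x)); congr (_ *: _ + _).
rewrite exprS (mulrA _ (para_conj x)) (mulrA (para_conj x)); congr (_ * _).
rewrite -/(GRing.comm _ _).
by apply/commr_sym/commrX; rewrite /GRing.comm para_conjC.
Qed.

(* The generating function of [fueter_poly j] is
   (1 - x)^(-j) (1 - conj x)^(1-j). *)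
Definition fueter_poly (j : nat) := rising_poly j%:R (j%:R - 1).

Lemma fueter_poly_rec j s x :
  fueter_poly j.+1 s.+2 x = trace_fun x * fueter_poly j.+1 s.+1 x -
    norm_fun x * fueter_poly j.+1 s x + fueter_poly j s.+2 x.
Proof.
rewrite /fueter_poly; set a := j.+1%:R; have a1 : a - 1 = j%:R by rewrite /a -natr1 addrK.
rewrite rising_poly_recl [X in _ + X]rising_poly_recr addrA a1; congr (_ + _).
(* The intermediate polynomial with both parameters equal to j is eliminated, so that x and conj x
   enter only through their sum and their product. *)
have -> : rising_poly j%:R j%:R s.+1 x =
    rising_poly a j%:R s.+1 x - para x * rising_poly a j%:R s x.
  by rewrite (rising_poly_recl a) a1 addrC addKr.
by rewrite mulrBr mulrA para_conjC addrA -mulrDl.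
Qed.

Lemma fueter_poly_rec1 j x :
  fueter_poly j.+1 1 x = trace_fun x + fueter_poly j 1 x.
Proof.
rewrite /fueter_poly; set a := j.+1%:R; have a1 : a - 1 = j%:R by rewrite /a -natr1 addrK.
by rewrite rising_poly_recl [X in _ + X]rising_poly_recr addrA a1 !rising_poly0 !mulr1.
Qed.

Lemma smooth_monomial k l : smooth (fun x => para x ^+ k * para_conj x ^+ l : clifford R n).
Proof.
by apply: smoothM; apply: smoothX; [exact: smooth_para | exact: smooth_para_conj].
Qed.

Lemma smooth_rising_poly a b s : smooth (rising_poly a b s).
Proof. by apply: smooth_sum => i; apply: smoothZ; exact: smooth_monomial. Qed.

Lemma euler_rising_poly a b s x :
  euler (rising_poly a b s) x = s%:R *: rising_poly a b s x.
Proof.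
rewrite /rising_poly euler_sum => [|i]; last by apply: smoothZ; exact: smooth_monomial.
rewrite scaler_sumr; apply: eq_bigr => i _.
rewrite eulerZ; last exact: smooth_monomial.
rewrite eulerM; try by apply: smoothX; [exact: smooth_para || exact: smooth_para_conj].
rewrite !eulerX; try exact: smooth_para; try exact: smooth_para_conj.
- rewrite -(scalerAl _ (para x ^+ _)) -(scalerAr _ (para x ^+ _)) -scalerDl.
  rewrite -natrD subnK ?scalerA 1?mulrC //.
  by rewrite -ltnS.
- by apply: euler_linear; exact: para_conj_linear.
- by apply: euler_linear; exact: para_linear.
Qed.

Lemma dird0X (f : pt -> clifford R n) k : smooth f -> dird (basis 0) f = (fun=> 1) ->
  dird (basis 0) (fun x => f x ^+ k) = fun x => k%:R *: f x ^+ k.-1.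
Proof.
move=> sf f1; elim: k => [|k IH].
  have -> : (fun x => f x ^+ 0) = fun=> 1 by apply/funext.
  rewrite dird_cst.
  by apply/funext => x; rewrite scale0r.
rewrite (_ : (fun _ => _) = fun x => f x * f x ^+ k); last first.
  by apply/funext => x; rewrite exprS.
rewrite dirdM //; last exact: smoothX.
rewrite IH f1; apply/funext => x; rewrite mul1r -scalerAr /=.
case: k {IH} => [|k]; first by rewrite scale0r addr0 scale1r.
by rewrite -exprS /= -[in RHS]nat1r scalerDl scale1r.
Qed.

Lemma para_basis0 : para (basis 0) = 1 :> clifford R n.
Proof.
rewrite /para /re mxE !eqxx scale1r /ve big1 ?addr0 // => l _.
by rewrite mxE /= scale0r.
Qed.

Lemma para_conj_basis0 : para_conj (basis 0) = 1 :> clifford R n.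
Proof.
rewrite /para_conj /re mxE !eqxx scale1r /ve big1 ?subr0 // => l _.
by rewrite mxE /= scale0r.
Qed.

(** Both x and conj x have derivative 1 along the real axis, so each monomial of degree s receives
    two contributions. Their factors a + s - i and b + i add up to a number free of i, which is why
    the parameters a, b are preserved. *)
Lemma dird0_rising_poly a b s x :
  dird (basis 0) (rising_poly a b s.+1) x = (a + b + s%:R) *: rising_poly a b s x.
Proof.
have sp := @smooth_para R n; have sc := @smooth_para_conj R n.
rewrite /rising_poly dird_sum => [|i]; last by apply: smoothZ; exact: smooth_monomial.
transitivity (\sum_(i < s.+2) (rising_coef a (s.+1 - i) * rising_coef b i *
      (s.+1 - i)%:R) *: (para x ^+ (s.+1 - i).-1 * para_conj x ^+ i)
    + \sum_(i < s.+2) (rising_coef a (s.+1 - i) * rising_coef b i * i%:R) *: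
      (para x ^+ (s.+1 - i) * para_conj x ^+ i.-1)).
  rewrite -big_split; apply: eq_bigr => i _ /=.
  rewrite dirdZ; last exact: smooth_monomial.
  rewrite dirdM; [|exact: smoothX..].
  rewrite (dird0X _ sp) ?(dird0X _ sc) ?dird_para ?dird_para_conj ?para_basis0 ?para_conj_basis0 //.
  by rewrite -(scalerAl _ (para x ^+ _)) -(scalerAr _ (para x ^+ _)) scalerDr !scalerA.
rewrite big_ord_recr /= subnn mulr0 scale0r addr0.
rewrite [X in _ + X]big_ord_recl /= mulr0 scale0r add0r -big_split scaler_sumr.
apply: eq_bigr => i _ /=; have is_ : (i <= s)%N by rewrite -ltnS.
rewrite /bump /= add1n subSS subSn //= -scalerDl [RHS]scalerA; congr (_ *: _).
transitivity ((s - i).+1%:R * rising_coef a (s - i).+1 * rising_coef b i +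
  rising_coef a (s - i) * (i.+1%:R * rising_coef b i.+1)); first by ring.
by rewrite !rising_coefS natrB //; ring.
Qed.

End RisingPolynomials.

Section FueterPolynomials.
Variables (R : realType) (n : nat).
Local Notation pt := 'rV[R]_n.+1.
Local Notation basis i := (delta_mx 0 i : pt).
Local Notation fueter := (@fueter_poly R n).

Lemma smooth_fueter_poly j s : smooth (fueter j s).
Proof. exact: smooth_rising_poly. Qed.

Lemma laplacian_fueter_poly0 j x : laplacian (fueter j 0) x = 0.
Proof.
rewrite (_ : fueter j 0 = fun=> 1); last by apply/funext => y; exact: rising_poly0.
by rewrite laplacianE big1 // => i _; rewrite !dird_cst.
Qed.

Lemma laplacian_linear (L : pt -> clifford R n) x :
  (forall (k : R) y z, L (k *: y + z) = k *: L y + L z) -> laplacian L x = 0.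
Proof.
by move=> Llin; rewrite laplacianE big1 // => i _; rewrite (dird_linear _ Llin) dird_cst.
Qed.

Lemma rising_poly1 (a b : R) x :
  rising_poly a b 1 x = a *: para x + b *: para_conj x :> clifford R n.
Proof.
have c1 (c : R) : rising_coef c 1 = c.
  by rewrite /rising_coef pochhammerS pochhammer0 mul1r addr0 divr1.
rewrite /rising_poly big_ord_recl big_ord1; congr (_ + _).
  by rewrite c1 rising_coef0 mulr1 expr0 mulr1 expr1.
by rewrite c1 rising_coef0 mul1r expr0 mul1r expr1.
Qed.

Lemma laplacian_fueter_poly1 j x : laplacian (fueter j 1) x = 0.
Proof.
have -> : fueter j 1 = fun x => j%:R *: para x + (j%:R - 1) *: para_conj x.
  by apply/funext => y; exact: rising_poly1.
have sp := @smooth_para R n; have sc := @smooth_para_conj R n.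
rewrite laplacianD; [|exact: smoothZ..].
rewrite !laplacianZ // laplacian_linear; last exact: para_linear.
by rewrite laplacian_linear ?scaler0 ?addr0 //; exact: para_conj_linear.
Qed.

(** For j = 0 the generating function is 1 - conj x, which stops at degree 1. *)
Lemma fueter_poly_0SS s x : fueter 0 s.+2 x = 0.
Proof.
rewrite /fueter_poly /rising_poly big1 // => i _.
have [->|si] := eqVneq (i : nat) s.+2.
  by rewrite {2}/rising_coef !pochhammerSl sub0r addNr mul0r mulr0 mul0r mulr0 scale0r.
have : (i < s.+2)%N by rewrite ltn_neqAle si -ltnS /=.
by rewrite -subn_gt0; case: (s.+2 - i)%N => // k _; rewrite rising_coef_0S mul0r scale0r.
Qed.

(** Up to a constant, the Laplacians for index j + 1 obey the recurrence of index j + 2 with the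
    same initial values. As this recurrence looks two degrees back, the inner induction carries two
    consecutive degrees. *)
Lemma laplacian_fueter_polySS h j s x : n = h.*2.+1 ->
  laplacian (fueter j s.+2) x =
  (-4 * j%:R * (h.+1%:R - j%:R)) *: fueter j.+1 s x.
Proof.
move=> nh; elim: j s x => [|j IHj] s x.
  rewrite mulr0 mul0r scale0r.
  rewrite (_ : fueter 0 s.+2 = fun=> 0); last by apply/funext => y; exact: fueter_poly_0SS.
  by rewrite laplacianE big1 // => i _; rewrite !dird_cst.
have sF := smooth_fueter_poly j.+1.
have st : smooth (@trace_fun R n) by exact: (smooth_linear (@trace_fun_linear R n)).
have sn : smooth (@norm_fun R n).
  by apply: smoothM; [exact: smooth_para | exact: smooth_para_conj].
(* The lower order terms of the two product rules and the term from the outer induction are all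
   multiples of [fueter j.+1 k]. Their factors 4 (2j + 1 + k), -4k - 2 (n + 1) and -4j (h + 1 - j)
   add up to -4 (j + 1)(h - j) because n = 2h + 1. *)
have step k : laplacian (fueter j.+1 k.+2) x =
    trace_fun x * laplacian (fueter j.+1 k.+1) x -
    norm_fun x * laplacian (fueter j.+1 k) x +
    (-4 * j.+1%:R * (h.+1%:R - j.+1%:R)) *: fueter j.+1 k x.
  rewrite (_ : fueter j.+1 k.+2 = fun x => (trace_fun x * fueter j.+1 k.+1 x +
    (-1) *: (norm_fun x * fueter j.+1 k x)) + fueter j k.+2 x); last first.
    by apply/funext => y; rewrite fueter_poly_rec scaleN1r.
  rewrite laplacianD; [|by apply: smoothD; [exact: smoothM | apply/smoothZ/smoothM]
    |exact: smooth_fueter_poly].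
  rewrite laplacianD; [|exact: smoothM|apply/smoothZ/smoothM => //].
  rewrite laplacianZ; last exact: smoothM.
  rewrite laplacian_traceM // laplacian_normM // IHj scaleN1r.
  rewrite dird0_rising_poly euler_rising_poly -/(fueter j.+1 k).
  set T := _ * laplacian _ _; set N := norm_fun x * _; set H := fueter j.+1 k x.
  rewrite !opprD !scalerA -addrA -[in RHS]addrA; rewrite -!(addrA T).
  congr (_ + _); rewrite addrCA -!addrA; congr (_ + _).
  rewrite -!scaleNr -!scalerDl; congr (_ *: _).
  rewrite nh -!natr1 -!muln2 !natrM; rewrite /GRing.scale /=; ring.
set c := -4 * _ * _ in step *.
suff [] : laplacian (fueter j.+1 s.+2) x = c *: fueter j.+2 s x /\
    laplacian (fueter j.+1 s.+3) x = c *: fueter j.+2 s.+1 x by [].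
elim: s => [|s [IH1 IH2]]; last first.
  split; first exact: IH2.
  rewrite step IH1 IH2 (fueter_poly_rec j.+1) -(scalerAr _ (trace_fun x)).
  rewrite -(scalerAr _ (norm_fun x)).
  by rewrite [RHS]scalerDr [X in _ = X + _]scalerBr.
have E0 : laplacian (fueter j.+1 2) x = c *: fueter j.+2 0 x.
  rewrite step laplacian_fueter_poly0 laplacian_fueter_poly1 !mulr0 subr0 add0r.
  by rewrite /fueter_poly !rising_poly0.
split; first exact: E0.
rewrite step E0 laplacian_fueter_poly1 mulr0 subr0 (fueter_poly_rec1 j.+1).
rewrite -(scalerAr _ (trace_fun x)) [RHS]scalerDr; congr (_ *: _ + _).
by rewrite /fueter_poly rising_poly0 mulr1.
Qed.

End FueterPolynomials.

(** * Majorants *)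

Section PolynomialBounds.
Variables (R : realType) (n : nat).
Local Notation pt := 'rV[R]_n.+1.
Implicit Types (f g : pt -> clifford R n) (x e : pt) (M d : R).

(** The bounds satisfied by M exp(d t) along [e]: under products M multiplies and d adds, by the
    square of d + d'. Two derivatives are what one Laplacian requires. *)
Definition bounded2 e x M d f : Prop :=
  [/\ cnorm (f x) <= M, cnorm (dird e f x) <= M * d
    & cnorm (dird e (dird e f) x) <= M * d ^+ 2].

Lemma bounded2D e x M M' d f g : smooth f -> smooth g ->
  bounded2 e x M d f -> bounded2 e x M' d g ->
  bounded2 e x (M + M') d (fun y => f y + g y).
Proof.
move=> sf sg [f0 f1 f2] [g0 g1 g2]; split.
- by apply: le_trans (cnormD _ _) _; exact: lerD.
- by rewrite dirdD // mulrDl; apply: le_trans (cnormD _ _) _; exact: lerD.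
- rewrite !dirdD //; try exact: smooth_dird.
  by rewrite mulrDl; apply: le_trans (cnormD _ _) _; exact: lerD.
Qed.

Lemma bounded2Z e x M d (k : R) f : smooth f ->
  bounded2 e x M d f -> bounded2 e x (`|k| * M) d (fun y => k *: f y).
Proof.
move=> sf [f0 f1 f2]; have sf1 := smooth_dird e sf.
by split; rewrite ?dirdZ // cnormZ -?mulrA ler_wpM2l.
Qed.

Lemma bounded2_le e x M M' d f : 0 <= d -> M <= M' ->
  bounded2 e x M d f -> bounded2 e x M' d f.
Proof.
move=> d0 MM [f0 f1 f2]; split; first exact: le_trans MM.
  by apply: le_trans f1 _; rewrite ler_wpM2r.
by apply: le_trans f2 _; rewrite ler_wpM2r ?exprn_ge0.
Qed.

Lemma bounded2M e x M M' d d' f g : smooth f -> smooth g ->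
  bounded2 e x M d f -> bounded2 e x M' d' g ->
  bounded2 e x (M * M') (d + d') (fun y => f y * g y).
Proof.
move=> sf sg [f0 f1 f2] [g0 g1 g2].
have sf1 := smooth_dird e sf; have sg1 := smooth_dird e sg.
have mle a b A B : cnorm (a : clifford R n) <= A -> cnorm b <= B -> cnorm (a * b) <= A * B.
  move=> aA bB; apply: le_trans (cnormM _ _) _; apply: ler_pM => //; exact: cnorm_ge0.
split; first exact: mle.
- rewrite dirdM //; apply: le_trans (cnormD _ _) _.
  apply: le_trans (lerD (mle _ _ _ _ f1 g0) (mle _ _ _ _ f0 g1)) _.
  rewrite le_eqVlt; apply/orP; left; apply/eqP; ring.
- rewrite dirdM // dirdD; [|exact: smoothM..].
  rewrite !dirdM //.
  apply: le_trans (cnormD _ _) _.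
  apply: le_trans (lerD (cnormD _ _) (cnormD _ _)) _.
  apply: le_trans (lerD (lerD (mle _ _ _ _ f2 g0) (mle _ _ _ _ f1 g1))
    (lerD (mle _ _ _ _ f1 g1) (mle _ _ _ _ f0 g2))) _.
  rewrite le_eqVlt; apply/orP; left; apply/eqP; ring.
Qed.

Lemma bounded2X e x M d f k : smooth f ->
  bounded2 e x M d f -> bounded2 e x (M ^+ k) (k%:R * d) (fun y => f y ^+ k).
Proof.
move=> sf bf; elim: k => [|k IH].
  have -> : (fun x => f x ^+ 0) = fun=> 1 by apply/funext.
  by split; rewrite ?dird_cst ?cnorm1 ?cnorm0 ?expr0 ?mul0r ?mulr0 ?expr0n ?mulr0.
have -> : (fun x => f x ^+ k.+1) = fun x => f x * f x ^+ k by apply/funext => y; rewrite exprS.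
rewrite exprS -nat1r mulrDl mul1r; apply: bounded2M => //; exact: smoothX.
Qed.

Lemma bounded2_linear e x r d (L : pt -> clifford R n) :
  (forall (k : R) y z, L (k *: y + z) = k *: L y + L z) -> 0 <= r ->
  cnorm (L x) <= r -> cnorm (L e) <= r * d -> bounded2 e x r d L.
Proof.
move=> Llin r0 Lx Le; split => //; first by rewrite (dird_linear _ Llin).
by rewrite (dird_linear _ Llin) dird_cst cnorm0 mulr_ge0 ?sqr_ge0.
Qed.

Lemma bounded2_sum e x d I (r : seq I) (F : I -> pt -> clifford R n) M :
  0 <= d -> (forall i, smooth (F i)) -> (forall i, bounded2 e x M d (F i)) ->
  bounded2 e x ((size r)%:R * M) d (fun y => \sum_(i <- r) F i y).
Proof.
move=> d0 sF bF; elim: r => [|i r IH].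
  under [fun y => _]funext do rewrite big_nil.
  by split; rewrite ?dird_cst ?cnorm0 ?mul0r.
under [fun y => _]funext do rewrite big_cons.
by rewrite /= -nat1r mulrDl mul1r; apply: bounded2D => //; exact: smooth_sum.
Qed.

(** Each of the s + 1 monomials has s linear factors, hence the rate s d, and carries two rising
    coefficients whose product is at most (1 + c)^s. *)
Lemma bounded2_rising_poly e x r d a b c s :
  0 <= d -> 0 <= r -> `|a| <= c -> `|b| <= c ->
  cnorm (para x) <= r -> cnorm (para_conj x) <= r ->
  cnorm (para e) <= r * d -> cnorm (para_conj e) <= r * d ->
  bounded2 e x (s.+1%:R * (((1 + c) * r) ^+ s)) (s%:R * d) (rising_poly a b s).
Proof.
move=> d0 r0 ac bc px cx pe ce.
have c0 : 0 <= 1 + c by rewrite addr_ge0 // (le_trans _ ac).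
rewrite (_ : s.+1 = size (index_enum 'I_s.+1)); last first.
  by rewrite -sum1_size big_const_ord iter_addn_0 mul1n.
apply: bounded2_sum; first by rewrite mulr_ge0.
  by move=> i; apply: smoothZ; exact: smooth_monomial.
move=> i; have is_ : (i <= s)%N by rewrite -ltnS.
have bm : bounded2 e x (r ^+ s) (s%:R * d)
    (fun x => para x ^+ (s - i) * para_conj x ^+ i).
  rewrite -[in r ^+ _](subnK is_) exprD -[in s%:R](subnK is_) natrD mulrDl.
  have sp := @smooth_para R n; have sc := @smooth_para_conj R n.
  apply: bounded2M; [exact: smoothX..| |].
    by apply: bounded2X => //; apply: bounded2_linear => //; exact: para_linear.
  by apply: bounded2X => //; apply: bounded2_linear => //; exact: para_conj_linear.
apply: (@bounded2_le e x (`|rising_coef a (s - i) * rising_coef b i| * r ^+ s)).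
- by rewrite mulr_ge0.
- rewrite exprMn ler_wpM2r ?exprn_ge0 // normrM -[in leRHS](subnK is_) exprD.
  by apply: ler_pM => //; exact: norm_rising_coef.
- by apply: bounded2Z => //; exact: smooth_monomial.
Qed.

Lemma norm_coord_le x i : `|x 0 i| <= `|x|.
Proof.
rewrite [leRHS]/Num.Def.normr/= mx_normrE.
exact: (le_bigmax _ (fun ij => `|x ij.1 ij.2|) (0, i)).
Qed.

Lemma cnorm_ve_le x : cnorm (ve x) <= n%:R * `|x|.
Proof.
apply: le_trans (cnorm_sum _ _ _) _.
apply: (@le_trans _ _ (\sum_(l < n) `|x|)); last first.
  by rewrite sumr_const card_ord mulr_natl.
apply: ler_sum => l _; rewrite cnormZ /gen cnorm_blade mulr1; exact: norm_coord_le.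
Qed.

Lemma cnorm_para_le x : cnorm (para x) <= n.+1%:R * `|x|.
Proof.
apply: le_trans (cnormD _ _) _; rewrite -nat1r mulrDl mul1r.
by apply: lerD (cnorm_ve_le x); rewrite cnormZ cnorm1 mulr1 norm_coord_le.
Qed.

Lemma cnorm_para_conj_le x : cnorm (para_conj x) <= n.+1%:R * `|x|.
Proof.
apply: le_trans (cnormD _ _) _; rewrite -nat1r mulrDl mul1r cnormN.
by apply: lerD (cnorm_ve_le x); rewrite cnormZ cnorm1 mulr1 norm_coord_le.
Qed.

End PolynomialBounds.

(** * Series of polynomials H_(j,s) *)

Lemma near_norm_lt (R : realType) (V : normedModType R) (x : V) (r : R) :
  `|x| < r -> \forall y \near x, `|y| < r.
Proof. by move=> xr; apply: (cvgr_norm_lt x) => //; exact: cvg_id. Qed.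

Section FueterSeries.
Variables (R : realType) (n h : nat) (q r : R).
Local Notation pt := 'rV[R]_n.+1.
Local Notation basis i := (delta_mx 0 i : pt).
Local Notation fueter := (@fueter_poly R n).
Hypotheses (q0 : 0 <= q) (r0 : 0 < r).
(** Here 8 = 2 * 4 absorbs the number s + 1 of monomials and the factor s^2 of two derivatives, 1 +
    (h + 1) bounds the rising coefficients, n + 1 compares [para] with the norm of the point, and q
    is the growth rate of the coefficients. *)
Hypothesis small : 8 * ((1 + h.+1%:R) * (n.+1%:R * r)) * q <= 1 / 2.

Definition fueter_series j (alpha : nat -> clifford R n) (x : pt) : clifford R n :=
  limn (series (fun s => fueter j s x * alpha s)).

Lemma natr_lt_expr2 s : s%:R <= 2 ^+ s :> R.
Proof. by rewrite -natrX ler_nat ltnW // ltn_expl. Qed.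

Lemma natrS_le_expr2 s : s.+1%:R <= 2 ^+ s :> R.
Proof. by rewrite -natrX ler_nat ltn_expl. Qed.

(** One bound, uniform on the ball of radius r, for a term of the series and its first two
    derivatives along [e]. *)
Definition majorant (C : R) (e : pt) s : R := C * (1 + `|e| / r) ^+ 2 * (1 / 2) ^+ s.

Lemma cvg_majorant C e : cvgn (series (majorant C e)).
Proof.
apply: is_cvg_geometric_series.
by rewrite ger0_norm ?divr_ge0 // ltr_pdivrMr // mul1r ltr1n.
Qed.

Lemma fueter_term_bound j s (a : clifford R n) C (e x : pt) :
  (j <= h.+1)%N -> 0 <= C -> cnorm a <= C * q ^+ s -> `|x| < r ->
  [/\ cnorm (fueter j s x * a) <= majorant C e s,
      cnorm (dird e (fueter j s) x * a) <= majorant C e s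
    & cnorm (dird e (dird e (fueter j s)) x * a) <= majorant C e s].
Proof.
move=> jh C0 aC xr; set k := `|e| / r; set m := n.+1%:R * r.
have k0 : 0 <= k by rewrite divr_ge0 // ltW.
have m0 : 0 <= m by rewrite mulr_ge0 // ltW.
have em : n.+1%:R * `|e| <= m * k.
  by rewrite /m /k -mulrA ler_wpM2l // mulrCA divff ?mulr1 // gt_eqF.
have xm : n.+1%:R * `|x| <= m by rewrite ler_wpM2l // ltW.
have jc : `|j%:R : R| <= h.+1%:R by rewrite normr_nat ler_nat.
have jc1 : `|j%:R - 1 : R| <= h.+1%:R.
  case: j jh {jc} => [|j] jh; first by rewrite sub0r normrN1 ler1n.
  by rewrite -natr1 addrK normr_nat ler_nat ltnW // ltnW.
have [] := @bounded2_rising_poly R n e x m k j%:R (j%:R - 1) h.+1%:R s k0 m0 jc jc1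
  (le_trans (cnorm_para_le x) xm) (le_trans (cnorm_para_conj_le x) xm)
  (le_trans (cnorm_para_le e) em) (le_trans (cnorm_para_conj_le e) em).
set P := (_ * m) ^+ s => b0 b1 b2.
have P0 : 0 <= P by rewrite exprn_ge0 // mulr_ge0.
(* [X] stands for 1, s k and (s k)^2, the costs of zero, one and two derivatives. *)
have key u X : cnorm u <= s.+1%:R * P * X -> 0 <= X -> X <= 4 ^+ s * (1 + k) ^+ 2 ->
    cnorm (u * a) <= majorant C e s.
  move=> uX X0 Xle; apply: le_trans (cnormM _ _) _.
  apply: le_trans (ler_pM (cnorm_ge0 _) (cnorm_ge0 _) uX aC) _.
  apply: (@le_trans _ _ (2 ^+ s * P * (4 ^+ s * (1 + k) ^+ 2) * (C * q ^+ s))).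
    rewrite ler_wpM2r ?mulr_ge0 ?exprn_ge0 //.
    apply: ler_pM => //; first by rewrite mulr_ge0.
    by rewrite ler_wpM2r // natrS_le_expr2.
  rewrite /majorant -/k.
  rewrite (_ : _ * (C * q ^+ s) = C * (1 + k) ^+ 2 * (8 * ((1 + h.+1%:R) * m) * q) ^+ s).
    apply: ler_wpM2l; first by rewrite mulr_ge0 ?sqr_ge0.
    rewrite lerXn2r // ?nnegrE ?divr_ge0 //.
    by rewrite mulr_ge0 // mulr_ge0 // mulr_ge0.
  have -> : 8 = 2 * 4 :> R by rewrite -natrM.
  rewrite /P !exprMn; ring.
have one_le : 1 <= (4 : R) ^+ s by apply: exprn_ege1; lra.
have four : (4 : R) = 2 * 2 by rewrite -natrM.
have sk0 : 0 <= s%:R * k by rewrite mulr_ge0.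
have sk : s%:R * k <= 2 ^+ s * (1 + k).
  by apply: ler_pM => //; [exact: natr_lt_expr2 | rewrite lerDr].
have big : 1 <= (2 : R) ^+ s * (1 + k).
  by rewrite -[leLHS]mulr1; apply: ler_pM => //; [apply: exprn_ege1; lra | rewrite lerDl].
have sq : 4 ^+ s * (1 + k) ^+ 2 = (2 ^+ s * (1 + k)) ^+ 2.
  by rewrite four exprMn expr2 [RHS]expr2; ring.
split.
- by apply: (key _ 1); rewrite ?mulr1 // sq exprn_ege1.
- apply: (key _ (s%:R * k)) => //; rewrite sq expr2.
  by rewrite -[leLHS]mulr1; apply: ler_pM.
- apply: (key _ ((s%:R * k) ^+ 2)) => //; first by rewrite sqr_ge0.
  by rewrite sq lerXn2r // nnegrE // (le_trans sk0).
Qed.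

(** Stated for any smooth [G], so that it serves both the polynomials and their first derivatives.
    The radius (r - |x|) / (1 + |e|) keeps t e + x inside the ball, and the summand 1 covers e =
    0. *)
Lemma is_derive_smooth_series (G : nat -> pt -> clifford R n)
    (alpha : nat -> clifford R n) (M : nat -> R) (e x : pt) :
  (forall s, smooth (G s)) -> cvgn (series M) ->
  (forall s y, `|y| < r ->
    cnorm (G s y * alpha s) <= M s /\ cnorm (dird e (G s) y * alpha s) <= M s) ->
  `|x| < r ->
  is_derive x e (fun y => limn (series (fun s => G s y * alpha s)))
    (limn (series (fun s => dird e (G s) x * alpha s))).
Proof.
move=> sG cM GM xr.
have e0 : 0 < 1 + `|e| by rewrite ltr_pwDl.
apply: (@is_derive_clifford_series R n _ M (fun s y => G s y * alpha s)
  (fun s y => dird e (G s) y * alpha s) x e ((r - `|x|) / (1 + `|e|))) => //.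
  by rewrite divr_gt0 // subr_gt0.
move=> s t; rewrite ltr_pdivlMr // => td.
have yr : `|t *: e + x| < r.
  apply: le_lt_trans (ler_normD _ _) _; rewrite -ltrBrDr; apply: le_lt_trans td.
  by rewrite normrZ ler_wpM2l // lerDr.
have [b1 b2] := GM s _ yr; split=> //.
by apply: is_derive_cmulr; exact: smooth_is_derive.
Qed.

Section Coefficients.
Variables (alpha : nat -> clifford R n) (C : R).
Hypotheses (C0 : 0 <= C) (alphaC : forall s, cnorm (alpha s) <= C * q ^+ s).

Lemma is_derive_fueter_series j (e x : pt) : (j <= h.+1)%N -> `|x| < r ->
  is_derive x e (fueter_series j alpha)
    (limn (series (fun s => dird e (fueter j s) x * alpha s))).
Proof.
move=> jh; apply: (is_derive_smooth_series (M := majorant C e)).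
- by move=> s; exact: smooth_fueter_poly.
- exact: cvg_majorant.
- by move=> s y yr; have [] := fueter_term_bound e jh C0 (alphaC s) yr.
Qed.

Lemma is_derive2_fueter_series j (e x : pt) : (j <= h.+1)%N -> `|x| < r ->
  is_derive x e (fun y => 'D_e (fueter_series j alpha) y)
    (limn (series (fun s => dird e (dird e (fueter j s)) x * alpha s))).
Proof.
move=> jh xr.
apply: (@near_eq_is_derive _ _ _
  (fun y => limn (series (fun s => dird e (fueter j s) y * alpha s)))).
  have ball_x := near_norm_lt xr.
  near=> y; have yr : `|y| < r by near: y; exact: ball_x.
  by have [_ ->] := is_derive_fueter_series e jh yr.
apply: (is_derive_smooth_series (G := fun s => dird e (fueter j s)) (M := majorant C e)) => //.
- by move=> s; apply/smooth_dird/smooth_fueter_poly.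
- exact: cvg_majorant.
- by move=> s y yr; have [] := fueter_term_bound e jh C0 (alphaC s) yr.
Unshelve. all: by end_near. Qed.

Lemma cvg_fueter_series j (x : pt) : (j <= h.+1)%N -> `|x| < r ->
  series (fun s => fueter j s x * alpha s) @ \oo --> fueter_series j alpha x.
Proof.
move=> jh xr; suff cv : cvgn (series (fun s => fueter j s x * alpha s)) by exact: cv.
apply: (@cvg_series_cnorm R n (majorant C 0) (fun s => fueter j s x * alpha s));
  first exact: cvg_majorant.
move=> s.
by have [] := fueter_term_bound 0 jh C0 (alphaC s) xr.
Qed.

(** Convergence of the new series is a premise because its index [j.+1] may leave the range up to
    [h.+1] covered by the bounds. *)
Lemma laplacian_fueter_series j (x : pt) : n = h.*2.+1 -> (j <= h.+1)%N -> `|x| < r ->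
  series (fun s => fueter j.+1 s x * alpha s.+2) @ \oo -->
    fueter_series j.+1 (fun s => alpha s.+2) x ->
  laplacian (fueter_series j alpha) x =
  (-4 * j%:R * (h.+1%:R - j%:R)) *: fueter_series j.+1 (fun s => alpha s.+2) x.
Proof.
move=> nh jh xr; set c := _ * _ * _ => cv.
pose D i s := dird (basis i) (dird (basis i) (fueter j s)) x * alpha s.
have cD i : series (D i) @ \oo --> limn (series (D i)).
  suff cDi : cvgn (series (D i)) by exact: cDi.
  apply: (@cvg_series_cnorm R n (majorant C (basis i)) (D i)); first exact: cvg_majorant.
  move=> s.
  by have [] := fueter_term_bound (basis i) jh C0 (alphaC s) xr.
have -> : laplacian (fueter_series j alpha) x = \sum_i limn (series (D i)).
  by apply: eq_bigr => i _; case: (is_derive2_fueter_series (basis i) jh xr).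
have c1 : series (fun s => laplacian (fueter j s) x * alpha s) @ \oo -->
    \sum_i limn (series (D i)).
  rewrite (_ : series _ = fun k => \sum_i series (D i) k); first exact: cvg_bigsum.
  apply/funext => k; rewrite /series /= [RHS]exchange_big /=; apply: eq_bigr => s _.
  by rewrite laplacianE mulr_suml.
(* The terms of degree 0 and 1 are harmonic, so the partial sums are compared after a shift by
   two. *)
have c2 : series (fun s => laplacian (fueter j s) x * alpha s) (k + 2)%N @[k --> \oo] -->
    \sum_i limn (series (D i)) by rewrite cvg_shiftn.
apply: (cvg_unique _ c2); first exact: norm_hausdorff.
rewrite (_ : (fun k => _) = fun k => c *: series (fun s => fueter j.+1 s x * alpha s.+2) k).
  by apply: cvgZ; [exact: cvg_cst | exact: cv].
apply/funext => k; rewrite /series /= addn2 !big_nat_recl //.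
rewrite laplacian_fueter_poly0 laplacian_fueter_poly1 !mul0r !add0r scaler_sumr.
by apply: eq_bigr => s _; rewrite (laplacian_fueter_polySS j s x nh) -scalerAl.
Qed.

End Coefficients.

End FueterSeries.

(** * Slices and uniqueness *)

Lemma is_derive_comp_linear (R : realType) (U V W : normedModType R) (L : U -> V)
    (f : V -> W) (x v : U) df :
  (forall (k : R) y z, L (k *: y + z) = k *: L y + L z) ->
  is_derive (L x) (L v) f df -> is_derive x v (f \o L) df.
Proof.
move=> Llin.
have e : (fun h : R => h^-1 *: (((f \o L) \o shift x) (h *: v) - (f \o L) x))
  = (fun h : R => h^-1 *: ((f \o shift (L x)) (h *: L v) - f (L x))).
  by apply/funext => h /=; rewrite Llin.
by move=> [fd fv]; apply: DeriveDef; rewrite ?/derivable ?/derive e.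
Qed.

Section Slices.
Variables (R : realType) (n : nat).
Local Notation pt := 'rV[R]_n.+1.
Implicit Types (w : 'rV[R]_n) (p v : (R * R)%type) (F G : R * R -> clifford R n).

Lemma slice_pt0 w p : slice_pt w p 0 ord0 = p.1.
Proof. by rewrite mxE unlift_none. Qed.

Lemma slice_ptl w p l : slice_pt w p 0 (lift ord0 l) = p.2 * w 0 l.
Proof. by rewrite mxE liftK. Qed.

Lemma pt_eqP (x y : pt) :
  x 0 ord0 = y 0 ord0 -> (forall l, x 0 (lift ord0 l) = y 0 (lift ord0 l)) -> x = y.
Proof. by move=> h0 hl; apply/rowP => i; case: (unliftP ord0 i) => [l ->|->]. Qed.

Lemma slice_pt_linear w (k : R) p v :
  slice_pt w (k *: p + v) = k *: slice_pt w p + slice_pt w v.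
Proof.
apply: pt_eqP => [|l]; rewrite !mxE ?unlift_none ?liftK //=.
by rewrite mulrDl mulrA.
Qed.

Lemma ve_slice_pt w p : ve (slice_pt w p) = p.2 *: imag w.
Proof.
rewrite /ve /imag scaler_sumr; apply: eq_bigr => l _.
by rewrite slice_ptl scalerA.
Qed.

Lemma para_slice_pt w p : para (slice_pt w p) = (p.1)%:A + p.2 *: imag w.
Proof. by rewrite /para ve_slice_pt /re slice_pt0. Qed.

Lemma para_conj_slice_pt w p : para_conj (slice_pt w p) = (p.1)%:A - p.2 *: imag w.
Proof. by rewrite /para_conj ve_slice_pt /re slice_pt0. Qed.

Lemma imag_sqr w : sphere w -> imag w * imag w = -1.
Proof.
move=> sw; have := ve_sqr (slice_pt w (0, 1)).
rewrite ve_slice_pt scale1r => ->; rewrite -[RHS]scaleN1r -scaleNr.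
congr (_ *: _); congr (- _); rewrite -[RHS]sw; apply: eq_bigr => l _.
by rewrite slice_ptl /= mul1r.
Qed.

Lemma comm_slice w (a b c d : R) :
  GRing.comm (a%:A + b *: imag w) (c%:A + d *: imag w : clifford R n).
Proof.
have cA (k : R) (y : clifford R n) : GRing.comm k%:A y.
  by rewrite /GRing.comm mulr_algl mulr_algr.
apply: commrD; first exact/commr_sym/cA.
apply/commr_sym/commrD; first exact/commr_sym/cA.
rewrite /GRing.comm -(scalerAl d (imag w)) -(scalerAr b (imag w)).
by rewrite -(scalerAl b (imag w)) -(scalerAr d (imag w)) !scalerA mulrC.
Qed.

Lemma comm_imag_para_conj w p : GRing.comm (imag w) (para_conj (slice_pt w p)).
Proof.
rewrite para_conj_slice_pt -scaleNr.
by have := comm_slice w 0 1 p.1 (- p.2); rewrite scale0r add0r scale1r.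
Qed.

Lemma comm_imag_para w p : GRing.comm (imag w) (para (slice_pt w p)).
Proof.
rewrite para_slice_pt.
by have := comm_slice w 0 1 p.1 p.2; rewrite scale0r add0r scale1r.
Qed.

Definition derivable2 F p := derivable F p (1, 0) /\ derivable F p (0, 1).

Definition zconj w p : clifford R n := para_conj (slice_pt w p).

Lemma is_derive_zconjX w k p v :
  is_derive p v (fun p => zconj w p ^+ k) (k%:R *: (zconj w v * zconj w p ^+ k.-1)).
Proof.
have lin (c : R) y z : zconj w (c *: y + z) = c *: zconj w y + zconj w z.
  by rewrite /zconj slice_pt_linear para_conj_linear.
have zc : GRing.comm (zconj w p) (zconj w v).
  by rewrite /zconj !para_conj_slice_pt -!scaleNr; exact: comm_slice.
elim: k => [|k IH].
  rewrite scale0r; have -> : (fun p => zconj w p ^+ 0) = cst 1 by apply/funext.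
  exact: is_derive_cst.
have -> : (fun p => zconj w p ^+ k.+1) = fun p => zconj w p * zconj w p ^+ k.
  by apply/funext => y; rewrite exprS.
apply: is_derive_eq (is_derive_cmul (is_derive_linear p v lin) IH) _.
rewrite -(scalerAr _ (zconj w p)) (mulrA (zconj w p)) zc -(mulrA (zconj w v)) /=.
case: k {IH} => [|k]; first by rewrite scale0r addr0 scale1r.
by rewrite /= -exprS -[in RHS]nat1r scalerDl scale1r.
Qed.

Lemma zconj10 w : zconj w (1, 0) = 1.
Proof. by rewrite /zconj para_conj_slice_pt /= scale0r subr0 scale1r. Qed.

Lemma zconj01 w : zconj w (0, 1) = - imag w.
Proof. by rewrite /zconj para_conj_slice_pt /= scale0r sub0r scale1r. Qed.

Lemma derivable2_zconjXM w k G p :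
  derivable2 G p -> derivable2 (fun p => zconj w p ^+ k * G p) p.
Proof.
move=> [G1 G2]; split.
  by case: (is_derive_cmul (is_derive_zconjX w k p (1, 0)) (derivableP G1)).
by case: (is_derive_cmul (is_derive_zconjX w k p (0, 1)) (derivableP G2)).
Qed.

(** On a slice [zconj] has partial derivatives 1 and -I, so dbar maps it to 1 - I^2 = 2. Its powers
    commute with I, which lets dbar pass through them to [G]. *)
Lemma dbar_zconjXM w k G p : sphere w -> derivable2 G p ->
  dbar w (fun p => zconj w p ^+ k * G p) p =
  (2 * k%:R) *: (zconj w p ^+ k.-1 * G p) + zconj w p ^+ k * dbar w G p.
Proof.
move=> sw [G1 G2]; rewrite /dbar.
have [_ ->] := is_derive_cmul (is_derive_zconjX w k p (1, 0)) (derivableP G1).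
have [_ ->] := is_derive_cmul (is_derive_zconjX w k p (0, 1)) (derivableP G2).
rewrite zconj10 zconj01 mul1r mulNr scalerN.
set I := imag w; set z := zconj w p ^+ k.-1; set Z := zconj w p ^+ k.
have IZ : I * Z = Z * I by apply: commrX; exact: comm_imag_para_conj.
have II : I * I = -1 by exact: imag_sqr.
rewrite (mulrDr I) (mulrDr Z) (mulrA I Z) IZ -(mulrA Z I) addrACA; congr (_ + _).
rewrite -!(scalerAl _ _ (G p)) mulNr mulrN -(scalerAl _ (I * z)) -(scalerAr _ I).
rewrite (mulrA I) (mulrA I) II mulN1r mulNr scalerN opprK.
by rewrite -scalerDl -mulr2n mulr_natl.
Qed.

End Slices.

Section SliceUniqueness.
Variables (R : realType) (n : nat) (w : 'rV[R]_n).
Implicit Types (p v : (R * R)%type) (F G : R * R -> clifford R n).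

Lemma dbar_near F G p : (\forall z \near p, F z = G z) -> dbar w F p = dbar w G p.
Proof. by move=> FG; rewrite /dbar !(near_eq_derive _ FG). Qed.

Lemma dbar_sum (I : Type) (r : seq I) (F : I -> R * R -> clifford R n) p :
  (forall i, derivable2 (F i) p) ->
  dbar w (fun z => \sum_(i <- r) F i z) p = \sum_(i <- r) dbar w (F i) p.
Proof.
move=> dF; rewrite /dbar.
have [_ ->] := is_derive_bigsum r (fun i => derivableP (dF i).1).
have [_ ->] := is_derive_bigsum r (fun i => derivableP (dF i).2).
by rewrite mulr_sumr -big_split.
Qed.

Lemma dbarZ (k : R) F p : derivable2 F p -> dbar w (fun z => k *: F z) p = k *: dbar w F p.
Proof.
move=> [F1 F2]; rewrite /dbar.
have [_ ->] := is_deriveZ k (derivableP F1).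
have [_ ->] := is_deriveZ k (derivableP F2).
by rewrite -(scalerAr k (imag w)) (scalerDr k ('D_(1, 0) F p)).
Qed.

Lemma dbarB F G p : derivable2 F p -> derivable2 G p ->
  dbar w (fun z => F z - G z) p = dbar w F p - dbar w G p.
Proof.
move=> [F1 F2] [G1 G2]; rewrite /dbar.
have [_ ->] := is_deriveB (derivableP F1) (derivableP G1).
have [_ ->] := is_deriveB (derivableP F2) (derivableP G2).
by rewrite (mulrBr (imag w)) opprD addrACA.
Qed.

Lemma derivable2Z (k : R) F p : derivable2 F p -> derivable2 (fun z => k *: F z) p.
Proof.
move=> [F1 F2]; split.
  by case: (is_deriveZ k (derivableP F1)).
by case: (is_deriveZ k (derivableP F2)).
Qed.

Lemma derivable2B F G p : derivable2 F p -> derivable2 G p ->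
  derivable2 (fun z => F z - G z) p.
Proof.
move=> [F1 F2] [G1 G2]; split.
  by case: (is_deriveB (derivableP F1) (derivableP G1)).
by case: (is_deriveB (derivableP F2) (derivableP G2)).
Qed.

(* Applying [dbar w] to the relation lowers the power of [zconj w] by one. *)
Lemma polyanalytic_unique (U : set (R * R)) m (H : 'I_m -> R * R -> clifford R n) :
  sphere w -> open U ->
  (forall k p, U p -> derivable2 (H k) p /\ dbar w (H k) p = 0) ->
  (forall p, U p -> \sum_(k < m) zconj w p ^+ k * H k p = 0) ->
  forall k p, U p -> H k p = 0.
Proof.
move=> sw oU; elim: m H => [|m IH] H dH H0 k p Up; first by case: k.
have near_U z : U z -> \forall y \near z, U y by move=> Uz; exact: open_nbhs_nbhs.
have HS : forall (i : 'I_m) z, U z -> H (lift ord0 i) z = 0.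
  have c0 (i : 'I_m) : 2 * i.+1%:R != 0 :> R by rewrite mulf_neq0 ?pnatr_eq0.
  have dH' (i : 'I_m) z : U z -> derivable2 (fun y => (2 * i.+1%:R) *: H (lift ord0 i) y) z /\
      dbar w (fun y => (2 * i.+1%:R) *: H (lift ord0 i) y) z = 0.
    move=> Uz; have [d1 d2] := dH (lift ord0 i) z Uz.
    by split; [exact: derivable2Z | rewrite dbarZ // d2 scaler0].
  move=> i z Uz; apply: (scalerI (c0 i)); rewrite scaler0.
  apply: (IH (fun i y => (2 * i.+1%:R) *: H (lift ord0 i) y) dH') => // y Uy.
  have : dbar w (fun p => \sum_(k < m.+1) zconj w p ^+ k * H k p) y = 0.
    rewrite (dbar_near (G := fun=> 0)); last by apply: filterS (near_U y Uy) => q; exact: H0.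
    by rewrite /dbar !derive_cst mulr0 addr0.
  rewrite dbar_sum => [|j]; last by apply: derivable2_zconjXM; case: (dH j y Uy).
  rewrite big_ord_recl dbar_zconjXM //; last by case: (dH ord0 y Uy).
  rewrite (dH ord0 y Uy).2 !mulr0 scale0r !add0r => sum0; rewrite -[RHS]sum0; apply: eq_bigr => j _.
  rewrite dbar_zconjXM //; last by case: (dH (lift ord0 j) y Uy).
  by rewrite (dH (lift ord0 j) y Uy).2 mulr0 addr0 /= -scalerAr.
case: (unliftP ord0 k) => [i ->|->]; first exact: HS.
by rewrite -(H0 p Up) big_ord_recl expr0 mul1r big1 ?addr0 // => i _; rewrite HS ?mulr0.
Qed.

End SliceUniqueness.

(** * Power series on a slice and the growth of their coefficients *)

Section PowerSeries.
Variables (R : realType) (n : nat).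
Local Notation pt := 'rV[R]_n.+1.

(** For j = 1 the generating function is the geometric series of 1 / (1 - x). *)
Lemma fueter_poly1E s (x : pt) : fueter_poly 1 s x = para x ^+ s :> clifford R n.
Proof.
rewrite /fueter_poly /rising_poly subrr big_ord_recl big1 => [|i _]; last first.
  by rewrite rising_coef_0S mulr0 scale0r.
rewrite addr0 subn0 rising_coef0 mulr1 expr0 mulr1 (_ : rising_coef _ _ = 1) ?scale1r //.
elim: s => [|s IH]; first by rewrite rising_coef0.
have s0 : s.+1%:R != 0 :> R by rewrite pnatr_eq0.
by apply: (mulfI s0); rewrite rising_coefS IH !mulr1 nat1r.
Qed.

Lemma dird_paraX s (e x : pt) : GRing.comm (para e) (para x : clifford R n) ->
  dird e (fun x => para x ^+ s : clifford R n) x = s%:R *: (para e * para x ^+ s.-1).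
Proof.
move=> ex; elim: s => [|s IH].
  have -> : (fun x : pt => para x ^+ 0 : clifford R n) = (fun=> 1) by [].
  by rewrite dird_cst scale0r.
have -> : (fun x : pt => para x ^+ s.+1 : clifford R n) = fun x => para x * para x ^+ s.
  by apply/funext => y; rewrite exprS.
have sp := @smooth_para R n.
rewrite dirdM //; last exact: smoothX.
rewrite IH dird_para -(scalerAr _ (para x)) (mulrA (para x)) -ex -(mulrA (para e)) /=.
case: s {IH} => [|s]; first by rewrite scale0r addr0 scale1r.
by rewrite /= -exprS -[in RHS]nat1r scalerDl scale1r.
Qed.

Lemma slice_derivative_paraX w s (p : R * R) : sphere w ->
  dird (slice_pt w (1, 0)) (fun x : pt => para x ^+ s : clifford R n) (slice_pt w p) +
  imag w * dird (slice_pt w (0, 1)) (fun x : pt => para x ^+ s : clifford R n) (slice_pt w p) = 0.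
Proof.
move=> sw.
have e1 : para (slice_pt w (1, 0)) = 1 :> clifford R n.
  by rewrite para_slice_pt /= scale0r addr0 scale1r.
have e2 : para (slice_pt w (0, 1)) = imag w :> clifford R n.
  by rewrite para_slice_pt /= scale0r add0r scale1r.
rewrite !dird_paraX ?e1 ?e2; [|exact: comm_imag_para|exact/commr_sym/commr1].
by rewrite mul1r -(scalerAr _ (imag w)) mulrA imag_sqr // mulN1r scalerN subrr.
Qed.

End PowerSeries.

Section SliceFueterSeries.
Variables (R : realType) (n h : nat) (q r : R).
Local Notation pt := 'rV[R]_n.+1.
Hypotheses (q0 : 0 <= q) (r0 : 0 < r).
Hypothesis small : 8 * ((1 + h.+1%:R) * (n.+1%:R * r)) * q <= 1 / 2.
Variables (alpha : nat -> clifford R n) (C : R).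
Hypotheses (C0 : 0 <= C) (alphaC : forall s, cnorm (alpha s) <= C * q ^+ s).

Lemma slice_monogenic_fueter_series w (p : R * R) :
  sphere w -> `|slice_pt w p| < r ->
  derivable2 (fueter_series 1 alpha \o slice_pt w) p /\
  dbar w (fueter_series 1 alpha \o slice_pt w) p = 0.
Proof.
move=> sw pr; set x := slice_pt w p.
have d v : is_derive p v (fueter_series 1 alpha \o slice_pt w)
    (limn (series (fun s => dird (slice_pt w v) (fueter_poly 1 s) x * alpha s))).
  apply: is_derive_comp_linear; first exact: slice_pt_linear.
  exact: (is_derive_fueter_series q0 r0 small C0 alphaC).
split; first by split; [case: (d (1, 0)) | case: (d (0, 1))].
have cv v : series (fun s => dird (slice_pt w v) (fueter_poly 1 s) x * alpha s) @ \oo -->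
    limn (series (fun s => dird (slice_pt w v) (fueter_poly 1 s) x * alpha s)).
  suff cD : cvgn (series (fun s => dird (slice_pt w v) (fueter_poly 1 s) x * alpha s)).
    exact: cD.
  apply: (@cvg_series_cnorm R n (majorant r C (slice_pt w v))); first exact: cvg_majorant.
  move=> s.
  have [_ bound _] :=
    fueter_term_bound (j := 1) q0 r0 small (slice_pt w v) isT C0 (alphaC s) pr.
  exact: bound.
rewrite /dbar; have [_ ->] := d (1, 0); have [_ ->] := d (0, 1).
have c := cvgD (cv (1, 0)) (cvg_cmull_series (c := imag w) (cv (0, 1))).
suff S0 : (series (fun s => dird (slice_pt w (1, 0)) (fueter_poly 1 s) x * alpha s) +
    series (fun s => imag w * (dird (slice_pt w (0, 1)) (fueter_poly 1 s) x * alpha s)))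
    = fun=> 0.
  rewrite S0 in c; have {}c := c (@eventually_filter : Filter \oo).
  rewrite -[LHS](cvg_lim (@norm_hausdorff R (clifford R n)) c).
  exact: (lim_cst (@norm_hausdorff R (clifford R n))).
apply/funext => k; rewrite addrfctE /series /= -big_split big1 // => s _.
rewrite [LHS]/= (mulrA (imag w)); apply: etrans (esym (mulrDl _ _ (alpha s))) _.
have -> : fueter_poly 1 s = fun x : pt => para x ^+ s.
  by apply/funext => y; exact: fueter_poly1E.
by rewrite slice_derivative_paraX // mul0r.
Qed.

End SliceFueterSeries.

(** At a real point x and conj x both equal t, and the terms of a convergent series are bounded;
    dividing by t^(k+s) gives growth at rate 1/t. *)
Lemma coefficient_bound (R : realType) (n k : nat) (t : R) (a : nat -> clifford R n) :
  0 < t -> cvgn (series (fun s => (t%:A : clifford R n) ^+ k * t%:A ^+ s * a s)) ->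
  exists2 C, 0 <= C & forall s, cnorm (a s) <= C * t^-1 ^+ s.
Proof.
move=> t0 /cvg_series_cvg_0 c0.
have /cvg_seq_bounded [M [_ bM]] : cvgn (fun s => (t%:A : clifford R n) ^+ k * t%:A ^+ s * a s).
  by apply/cvg_ex; exists 0.
pose B := `|M| + 1; have B0 : 0 <= B by rewrite addr_ge0.
exists (#|{set 'I_n}|%:R * B / t ^+ k).
  by rewrite divr_ge0 ?exprn_ge0 ?(ltW t0) // mulr_ge0.
move=> s; have MB : M < B by rewrite /B (le_lt_trans (ler_norm M)) // ltrDl.
have {bM} := bM B MB s I.
rewrite /= -exprD exprZn expr1n mulr_algl normrZ normrX (gtr0_norm t0) => bM.
apply: le_trans (cnorm_le_normr _) _; rewrite -!mulrA ler_wpM2l // exprVn -invfM.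
by rewrite -exprD ler_pdivlMr ?exprn_gt0 // mulrC.
Qed.

(** * Existence of the decomposition *)

Lemma near_eq_differentiable (R : numFieldType) (V W : normedModType R)
    (f g : V -> W) (x : V) :
  (\forall y \near x, f y = g y) -> differentiable f x -> differentiable g x.
Proof.
move=> fg df; have [dc dl] := (diff_locallyP x f).1 df.
have fgx : f x = g x := nbhs_singleton fg.
have key : g \o shift x = cst (g x) + 'd f x +o_ (0 : V) id.
  apply/eqaddoP => e e0; move/eqaddoP: dl => /(_ e e0) dl.
  have fg0 : \forall h \near (0 : V), f (h + x) = g (h + x).
    by move: fg; rewrite (near_shift 0 x) /=; apply: filterS => h; rewrite subr0.
  near=> h; have E : f (h + x) = g (h + x) by near: h.
  have : `|((f \o shift x) - (cst (f x) + 'd f x)) h| <= e * `|h| by near: h; exact: dl.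
  by rewrite !fctE /= E fgx.
by apply/diff_locallyP; rewrite (diff_unique dc key).
Unshelve. all: by end_near. Qed.

Section ContinuouslyDifferentiable.
Variables (R : realType) (n : nat) (Omega : set 'rV[R]_n.+1).
Hypothesis oOmega : open Omega.
Local Notation pt := 'rV[R]_n.+1.
Implicit Types (f g : pt -> clifford R n) (x : pt).

Lemma near_Omega x : Omega x -> \forall y \near x, Omega y.
Proof. by move=> Ox; exact: open_nbhs_nbhs. Qed.

Lemma Ck_ext k f g : (forall x, Omega x -> f x = g x) -> Ck k Omega f -> Ck k Omega g.
Proof.
have ev (u v : pt -> clifford R n) x : (forall x, Omega x -> u x = v x) -> Omega x ->
    \forall y \near x, u y = v y.
  by move=> uv Ox; apply: filterS (near_Omega Ox) => y; exact: uv.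
elim: k f g => [|k IH] f g fg /=.
  move=> cf x Ox; suff : g @ x --> g x by []; rewrite -(fg x Ox).
  move: (cf x Ox); rewrite /continuous_at; apply: cvg_trans.
  exact: (@near_eq_cvg _ _ (nbhs x) _ f g (ev f g x fg Ox)).
move=> [df pf]; split=> [x Ox|i].
  by apply: near_eq_differentiable (df x Ox); exact: ev.
apply: IH (pf i) => x Ox; apply: near_eq_derive; exact: ev.
Qed.

Lemma Ck_cst k (c : clifford R n) : Ck k Omega (fun=> c).
Proof.
elim: k c => [|k IH] c /=; first by move=> x _; exact: cst_continuous.
split=> [x _|i]; first exact: differentiable_cst.
by apply: Ck_ext (IH 0) => x _; rewrite /partial; case: (is_derive_cst c x (delta_mx 0 i : pt)).
Qed.

Lemma CkD k f g : Ck k Omega f -> Ck k Omega g -> Ck k Omega (fun x => f x + g x).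
Proof.
elim: k f g => [|k IH] f g /=.
  by move=> cf cg x Ox; exact: (continuousD (cf x Ox) (cg x Ox)).
move=> [df pf] [dg pg]; split=> [x Ox|i].
  by apply: differentiableD; [exact: df | exact: dg].
apply: Ck_ext (IH _ _ (pf i) (pg i)) => x Ox.
have f1 := diff_derivable (v := delta_mx 0 i) (df x Ox).
have g1 := diff_derivable (v := delta_mx 0 i) (dg x Ox).
by rewrite /partial -deriveD.
Qed.

Lemma Ck_cmul k f (c : clifford R n) : Ck k Omega f -> Ck k Omega (fun x => c * f x).
Proof.
elim: k f => [|k IH] f /=.
  move=> cf x Ox.
  exact: (@cvg_cmul R n pt (nbhs x) (fun=> c) f c (f x) _ (cvg_cst c) (cf x Ox)).
move=> [df pf]; split=> [x Ox|i].
  by apply: differentiable_cmul; [exact: differentiable_cst | exact: df].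
apply: Ck_ext (IH _ (pf i)) => x Ox.
have f1 := diff_derivable (v := delta_mx 0 i) (df x Ox).
by rewrite /partial; have [_ ->] := is_derive_cmull c (derivableP f1).
Qed.

Lemma Ck_sum k (I : Type) (r : seq I) (F : I -> pt -> clifford R n) :
  (forall i, Ck k Omega (F i)) -> Ck k Omega (fun x => \sum_(i <- r) F i x).
Proof.
move=> CF; elim: r => [|i r IH].
  by apply: Ck_ext (Ck_cst k 0) => x _; rewrite big_nil.
by apply: Ck_ext (CkD (CF i) IH) => x _; rewrite big_cons.
Qed.

(** The operator d_u + I d_v in ambient partial derivatives, d_v being the derivative in direction
    w. With I frozen, the result is again a function on the ambient space and can be differentiated
    further. *)
Definition slice_dbar (w : 'rV[R]_n) f x : clifford R n :=
  partial ord0 f x + \sum_(l < n) (w 0 l *: imag w) * partial (lift ord0 l) f x.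

Lemma Ck_slice_dbar k (w : 'rV[R]_n) f : Ck k.+1 Omega f -> Ck k Omega (slice_dbar w f).
Proof.
move=> [_ pf]; apply: CkD; first exact: pf.
by apply: Ck_sum => l; apply: Ck_cmul; exact: pf.
Qed.

End ContinuouslyDifferentiable.

Section SliceRestriction.
Variables (R : realType) (n : nat).
Local Notation pt := 'rV[R]_n.+1.
Implicit Types (f : pt -> clifford R n) (w : 'rV[R]_n) (p : (R * R)%type).

Lemma differentiable_rV (V : normedModType R) m (M : V -> 'rV[R]_m) x :
  (forall i, differentiable (fun y => M y 0 i : R) x) -> differentiable M x.
Proof.
move=> dM; have -> : M = \sum_(i < m) (fun y => M y 0 i *: delta_mx 0 i : 'rV[R]_m).
  by apply/funext => y; rewrite fct_sumE -row_sum_delta.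
by apply: differentiable_sum => i; exact: differentiableZl.
Qed.

Lemma differentiable_fst p : differentiable (fun z : R * R => z.1) p.
Proof. by apply: (@linear_differentiable _ _ _ fst) => z; exact: cvg_fst. Qed.

Lemma differentiable_snd p : differentiable (fun z : R * R => z.2) p.
Proof. by apply: (@linear_differentiable _ _ _ snd) => z; exact: cvg_snd. Qed.

Lemma differentiable_slice_pt w p : differentiable (slice_pt w) p.
Proof.
apply: differentiable_rV => i; case: (unliftP ord0 i) => [l ->|->].
  under [fun y => _]funext do rewrite slice_ptl.
  by apply: differentiableM; [exact: differentiable_snd | exact: differentiable_cst].
under [fun y => _]funext do rewrite slice_pt0.
exact: differentiable_fst.
Qed.

Lemma continuous_slice_pt w : continuous (slice_pt w).
Proof. by move=> p; exact/differentiable_continuous/differentiable_slice_pt. Qed.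

Lemma slice_pt10 w : slice_pt w (1, 0) = delta_mx 0 ord0.
Proof.
apply: pt_eqP => [|l]; rewrite ?slice_pt0 ?slice_ptl mxE eqxx //=.
by rewrite mul0r.
Qed.

Lemma slice_pt01 w : slice_pt w (0, 1) = \sum_(l < n) w 0 l *: delta_mx 0 (lift ord0 l).
Proof.
apply: pt_eqP => [|k]; rewrite ?slice_pt0 ?slice_ptl summxE /=.
  by rewrite big1 // => l _; rewrite !mxE /= mulr0.
rewrite mul1r (bigD1 k) //= !mxE !eqxx mulr1 big1 ?addr0 // => l lk.
by rewrite !mxE eqxx /= (inj_eq lift_inj) eq_sym (negbTE lk) mulr0.
Qed.

Lemma dbar_slice f w p : differentiable f (slice_pt w p) ->
  dbar w (f \o slice_pt w) p = slice_dbar w f (slice_pt w p).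
Proof.
move=> df; rewrite /dbar /slice_dbar.
have D v : 'D_v (f \o slice_pt w) p = 'd f (slice_pt w p) (slice_pt w v).
  rewrite -deriveE //.
  have fd := derivableP (diff_derivable (v := slice_pt w v) df).
  by case: (is_derive_comp_linear (@slice_pt_linear R n w) fd).
rewrite !D slice_pt10 slice_pt01 linear_sum mulr_sumr /partial -deriveE //.
congr (_ + _); apply: eq_bigr => l _.
by rewrite linearZ /= -deriveE // -(scalerAr _ (imag w)) (scalerAl _ (imag w)).
Qed.

(** Each dbar uses up one order of differentiability of an ambient function. The witness depends on
    [w], but only its class is of interest. *)
Lemma iter_dbar_slice (Omega : set pt) k j f w : open Omega -> open (slice w Omega) ->
  Ck (j + k) Omega f ->
  exists2 g, Ck k Omega g &
    forall p, slice w Omega p -> iter j (dbar w) (f \o slice_pt w) p = g (slice_pt w p).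
Proof.
move=> oO oS; elim: j k => [|j IH] k Cf; first by exists f.
rewrite addSnnS in Cf; have [g Cg gE] := IH _ Cf.
exists (slice_dbar w g); first exact: Ck_slice_dbar.
move=> p Sp; rewrite iterS -dbar_slice; last by case: Cg => dg _; exact: dg.
apply: dbar_near; apply: filterS (open_nbhs_nbhs (conj oS Sp)) => z Sz.
by rewrite gE.
Qed.

End SliceRestriction.

(** * Stem functions: independence of the choice of slice *)

Section Stems.
Variables (R : realType) (n : nat) (D : set (R * R)).
Implicit Types (w : 'rV[R]_n) (p v : (R * R)%type) (F : 'rV[R]_n -> R * R -> clifford R n).

Definition flip p : R * R := (p.1, - p.2).

Lemma flipK p : flip (flip p) = p.
Proof. by case: p => u v; rewrite /flip /= opprK. Qed.

Lemma flip_linear (k : R) p v : flip (k *: p + v) = k *: flip p + flip v.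
Proof. by rewrite /flip /= opprD -scalerN. Qed.

Lemma differentiable_flip p : differentiable flip p.
Proof.
apply: differentiable_pair; first exact: differentiable_fst.
by apply: differentiableN; exact: differentiable_snd.
Qed.

Lemma slice_pt_flip w p : slice_pt w (flip p) = slice_pt (- w) p.
Proof. by apply: pt_eqP => [|l]; rewrite ?slice_pt0 ?slice_ptl //= mxE mulrN mulNr. Qed.

Lemma imagN w : imag (- w) = - imag w.
Proof. by rewrite /imag -sumrN; apply: eq_bigr => l _; rewrite mxE scaleNr. Qed.

Lemma sphereN w : sphere w -> sphere (- w).
Proof. by rewrite /sphere /= => <-; apply: eq_bigr => l _; rewrite mxE sqrrN. Qed.

(** The functions a, b are shared by all slices: this is what makes a family indexed by w come from
    one function of the point. *)
Definition stem F : Prop := exists a b : R * R -> clifford R n,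
  [/\ forall p, D p -> a (flip p) = a p,
      forall p, D p -> b (flip p) = - b p
    & forall w, sphere w -> forall p, D p -> F w p = a p + imag w * b p].

(** Two representations of a point coincide, or differ by a simultaneous change of sign of w and v,
    or the point is real; in the last case w is arbitrary, but oddness forces b to vanish. *)
Lemma stem_well_defined F w w' p p' : stem F -> sphere w -> sphere w' ->
  D p -> D p' -> slice_pt w p = slice_pt w' p' -> F w p = F w' p'.
Proof.
move=> [a [b [a_even b_odd FE]]] sw sw' Dp Dp' E; rewrite !FE //.
have E1 : p.1 = p'.1 by have := congr1 (fun x : 'rV_n.+1 => x 0 ord0) E; rewrite !slice_pt0.
have E2 l : p.2 * w 0 l = p'.2 * w' 0 l.
  by have := congr1 (fun x : 'rV_n.+1 => x 0 (lift ord0 l)) E; rewrite !slice_ptl.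
have sq : p.2 ^+ 2 = p'.2 ^+ 2.
  rewrite -[LHS]mulr1 -[RHS]mulr1 -{1}sw -sw' !mulr_sumr; apply: eq_bigr => l _.
  by rewrite -!exprMn E2.
have [p20|p20] := eqVneq p.2 0.
  have p'20 : p'.2 = 0 by apply/eqP; rewrite -sqrf_eq0 -sq p20 expr0n.
  have pp' : p = p' by case: (p) (p') E1 p20 p'20 => u v [u' v'] /= -> -> ->.
  have fp : flip p = p by case: (p) p20 => u v /= ->; rewrite /flip oppr0.
  suff b0 : b p = 0 by rewrite -pp' b0 !mulr0.
  have := b_odd p Dp; rewrite fp => /eqP; rewrite -addr_eq0 -mulr2n -scaler_nat.
  by rewrite scaler_eq0 pnatr_eq0 /= => /eqP.
move: sq => /eqP; rewrite eqf_sqr => /orP[] /eqP pp2.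
  have -> : p = p' by case: (p) (p') E1 pp2 => u v [u' v'] /= -> ->.
  have -> // : w = w'.
  by apply/rowP => l; apply: (mulfI p20); rewrite E2 pp2.
have pp' : p' = flip p by case: (p) (p') E1 pp2 => u v [u' v'] /= -> ->; rewrite /flip opprK.
have -> : w' = - w.
  by apply/rowP => l; apply: (mulfI p20); rewrite mxE mulrN E2 pp2 mulNr.
by rewrite pp' a_even // b_odd // imagN mulrNN.
Qed.

Lemma derive_flip (G : R * R -> clifford R n) (c : R) p :
  (forall z, G (flip z) = c *: G z) -> differentiable G p -> differentiable G (flip p) ->
  'D_(1, 0) G (flip p) = c *: 'D_(1, 0) G p /\
  'D_(0, 1) G (flip p) = - (c *: 'D_(0, 1) G p).
Proof.
move=> GE dp dfp.
have key v : 'D_(flip v) G (flip p) = c *: 'D_v G p.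
  have [_ <-] := is_derive_comp_linear flip_linear
    (derivableP (diff_derivable (v := flip v) dfp)).
  have -> : G \o flip = c *: G by apply/funext => z /=; rewrite GE.
  by rewrite deriveZ //; exact: diff_derivable.
split; first by rewrite -key /flip /= oppr0.
rewrite -key [in RHS]deriveE // deriveE // -linearN; congr ('d _ _ _).
by rewrite /flip /= -[RHS]/(- 0, - - 1) oppr0 opprK.
Qed.

(** From F = a + I b one gets dbar F = (a_u - b_v) + I (a_v + b_u), where the two brackets are again
    even and odd in v. *)
Lemma stem_dbar F w0 : sphere w0 -> open D -> (forall p, D p -> D (flip p)) ->
  (forall w, sphere w -> forall p, D p -> differentiable (F w) p) ->
  stem F -> stem (fun w => dbar w (F w)).
Proof.
move=> sw0 oD Dflip dF [a [b [a_even b_odd FE]]].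
(* The given a and b carry no regularity. On D they are recovered from one slice as the even part of
   [F w0] and as -I times its odd part, which are differentiable there and have the right parity
   everywhere. *)
pose a0 p := (1 / 2) *: (F w0 p + F w0 (flip p)).
pose b0 p := (- (1 / 2)) *: (imag w0 * (F w0 p - F w0 (flip p))).
have half (u : clifford R n) : (1 / 2) *: (u + u) = u.
  by rewrite -mulr2n -(scaler_nat 2 u) scalerA divfK ?pnatr_eq0 // scale1r.
have a0E p : D p -> a0 p = a p.
  move=> Dp; rewrite /a0 !FE //; last exact: Dflip.
  by rewrite a_even // b_odd // mulrN addrACA subrr addr0 half.
have b0E p : D p -> b0 p = b p.
  move=> Dp; rewrite /b0 !FE //; last exact: Dflip.
  rewrite a_even // b_odd // mulrN opprD opprK addrACA subrr add0r.
  by rewrite -mulrDr mulrA imag_sqr // mulN1r scaleNr scalerN opprK half.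
have a0f p : a0 (flip p) = 1 *: a0 p by rewrite /a0 flipK addrC scale1r.
have b0f p : b0 (flip p) = (-1) *: b0 p.
  by rewrite /b0 flipK scaleN1r -[RHS]scalerN -(mulrN (imag w0)) opprB.
have dFf p : D p -> differentiable (fun z => F w0 (flip z)) p.
  move=> Dp; apply: (@differentiable_comp _ _ _ _ flip (F w0)).
    exact: differentiable_flip.
  by apply: dF => //; exact: Dflip.
have da0 p : D p -> differentiable a0 p.
  by move=> Dp; apply: differentiableZ; apply: differentiableD; [exact: dF | exact: dFf].
have db0 p : D p -> differentiable b0 p.
  move=> Dp; apply: differentiableZ; apply: differentiable_cmul.
    exact: differentiable_cst.
  by apply: differentiableB; [exact: dF | exact: dFf].
exists (fun p => 'D_(1, 0) a0 p - 'D_(0, 1) b0 p).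
exists (fun p => 'D_(0, 1) a0 p + 'D_(1, 0) b0 p).
split=> [p Dp|p Dp|w sw p Dp].
- have [-> _] := derive_flip a0f (da0 p Dp) (da0 _ (Dflip p Dp)).
  have [_ ->] := derive_flip b0f (db0 p Dp) (db0 _ (Dflip p Dp)).
  by rewrite scale1r scaleN1r opprK.
- have [_ ->] := derive_flip a0f (da0 p Dp) (da0 _ (Dflip p Dp)).
  have [-> _] := derive_flip b0f (db0 p Dp) (db0 _ (Dflip p Dp)).
  by rewrite scale1r scaleN1r opprD.
have -> : dbar w (F w) p = dbar w (fun z => a0 z + imag w * b0 z) p.
  apply: dbar_near; apply: filterS (open_nbhs_nbhs (conj oD Dp)) => z Dz.
  by rewrite FE // a0E // b0E.
rewrite /dbar.
have A v := derivableP (diff_derivable (v := v) (da0 p Dp)).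
have B v := derivableP (diff_derivable (v := v) (db0 p Dp)).
have E v : 'D_v (fun z => a0 z + imag w * b0 z) p = 'D_v a0 p + imag w * 'D_v b0 p.
  by have [_ ->] := is_deriveD (A v) (is_derive_cmull (imag w) (B v)).
rewrite !E (mulrDr (imag w)) (mulrA (imag w)) imag_sqr // mulN1r (mulrDr (imag w)).
by rewrite addrACA [in RHS]addrACA; congr (_ + _); rewrite addrC.
Qed.

End Stems.

(** * Components recovered from the iterated dbar derivatives *)

Lemma sum_triangle (V : zmodType) (f : nat -> nat -> V) M :
  \sum_(k < M) \sum_(i < M - k) f k i = \sum_(j < M) \sum_(k < j.+1) f k (j - k)%N.
Proof.
elim: M => [|M IH]; first by rewrite !big_ord0.
rewrite [RHS]big_ord_recr /= -IH big_ord_recr /= subSnn big_ord1.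
rewrite [X in _ = _ + X]big_ord_recr /= subnn addrA; congr (_ + _).
rewrite -big_split; apply: eq_bigr => k _ /=.
by rewrite subSn ?(ltnW (ltn_ord k)) // big_ord_recr.
Qed.

Section SliceDecomposition.
Variables (R : realType) (n m : nat) (w : 'rV[R]_n) (F : nat -> R * R -> clifford R n).

(** On a slice dbar acts on powers of [zconj] as twice the derivative, whence the power of 2:
    [component] is 1/k! times the Taylor polynomial of (dbar/2)^k F with displacement -[zconj]. *)
Definition component_coef k i : R := (-1) ^+ i / (2 ^+ (k + i) * (i`!%:R * k`!%:R)).

(* The coefficients invert the Taylor expansion in the variable [zconj]. *)
Definition component k p : clifford R n :=
  \sum_(i < m.+1 - k) component_coef k i *: (zconj w p ^+ i * F (k + i) p).

Lemma component_coefS k i :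
  component_coef k i.+1 * (2 * i.+1%:R) = - component_coef k i.
Proof.
rewrite /component_coef addnS !exprS factS natrM.
have h1 : i.+1%:R != 0 :> R by rewrite pnatr_eq0.
have h2 := factr_neq0 R i; have h3 := factr_neq0 R k.
have h4 : (2 : R) ^+ (k + i) != 0 by rewrite expf_neq0 // pnatr_eq0.
by field; rewrite h2 h3 h4 nat1r h1.
Qed.

(** After 1 / (2^j j!) is factored out, this is the binomial expansion of (1 - 1)^j. *)
Lemma sum_component_coef j :
  \sum_(k < j.+1) component_coef k (j - k) = (j == 0)%:R.
Proof.
have -> : \sum_(k < j.+1) component_coef k (j - k) =
    (2 ^+ j * j`!%:R)^-1 * \sum_(k < j.+1) ((-1) ^+ (j - k) * 1 ^+ k) *+ 'C(j, k).
  rewrite mulr_sumr; apply: eq_bigr => k _; have kj : (k <= j)%N by rewrite -ltnS.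
  rewrite /component_coef subnKC // expr1n mulr1 -(bin_fact kj) -mulr_natr !natrM.
  have h1 : 'C(j, k)%:R != 0 :> R by rewrite pnatr_eq0 -lt0n bin_gt0.
  have h2 := factr_neq0 R (j - k); have h3 := factr_neq0 R k.
  have h4 : (2 : R) ^+ j != 0 by rewrite expf_neq0 // pnatr_eq0.
  by field; rewrite h1 h2 h3 mul1r h4.
rewrite -exprDn addNr expr0n; case: j => [|j]; last by rewrite mulr0.
by rewrite expr0 fact0 !mulr1 invr1.
Qed.

(** Grouped by the total order j = k + i, the double sum retains only j = 0. *)
Lemma sum_component p : \sum_(k < m.+1) zconj w p ^+ k * component k p = F 0 p.
Proof.
have -> : \sum_(k < m.+1) zconj w p ^+ k * component k p =
    \sum_(k < m.+1) \sum_(i < m.+1 - k)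
      component_coef k i *: (zconj w p ^+ (k + i) * F (k + i) p).
  apply: eq_bigr => k _; rewrite /component mulr_sumr; apply: eq_bigr => i _.
  by rewrite -(scalerAr _ (zconj w p ^+ k)) (mulrA (zconj w p ^+ k)) exprD.
rewrite (sum_triangle (fun k i => component_coef k i *: (zconj w p ^+ (k + i) * F (k + i) p))).
rewrite big_ord_recl big_ord1 subn0 big1 => [|j _].
  have -> : component_coef 0 0 = 1.
    by have := sum_component_coef 0; rewrite big_ord1.
  by rewrite addr0 scale1r expr0 mul1r.
rewrite (eq_bigr (fun k : 'I_(lift ord0 j).+1 => component_coef k (lift ord0 j - k) *:
   (zconj w p ^+ (lift ord0 j) * F (lift ord0 j) p))) => [|k _]; last first.
  by rewrite subnKC // -ltnS.
by rewrite -scaler_suml sum_component_coef scale0r.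
Qed.

Lemma dbar_component k p : sphere w -> (k <= m)%N ->
  (forall j, (j <= m)%N -> differentiable (F j) p) ->
  (forall j, (j <= m)%N -> dbar w (F j) p = F j.+1 p) -> F m.+1 p = 0 ->
  differentiable (component k) p /\ dbar w (component k) p = 0.
Proof.
move=> sw km dF dbF F0.
have ki (i : 'I_(m.+1 - k)) : (k + i <= m)%N.
  by have := ltn_ord i; rewrite ltn_subRL ltnS.
have dz (i : nat) : differentiable (fun p => zconj w p ^+ i) p.
  elim: i => [|i IH]; first exact: differentiable_cst.
  have -> : (fun p => zconj w p ^+ i.+1) = fun p => zconj w p * zconj w p ^+ i.
    by apply/funext => y; rewrite exprS.
  apply: differentiable_cmul; last exact: IH.
  have -> : zconj w = (fun z => z.1 *: 1) - (fun z => z.2 *: imag w).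
    by apply/funext => z; rewrite /zconj para_conj_slice_pt.
  apply: differentiableB; apply: differentiableZl.
    exact: differentiable_fst.
  exact: differentiable_snd.
have dt (i : 'I_(m.+1 - k)) : differentiable (fun p => zconj w p ^+ i * F (k + i) p) p.
  by apply: differentiable_cmul; [exact: dz | exact: dF].
have d2 (G : R * R -> clifford R n) : differentiable G p -> derivable2 G p.
  by move=> dG; split; exact: diff_derivable.
split; first by apply: differentiable_bigsum => i; exact: differentiableZ.
rewrite /component dbar_sum => [|i]; last by apply/derivable2Z/d2.
(* The i-th term contributes T i from the power of [zconj] and -T (i + 1) from dbar of F. The sum
   telescopes: T 0 contains the factor 0, and the last T contains F (m + 1) p = 0. *)
pose T i := component_coef k i *: ((2 * i%:R) *: (zconj w p ^+ i.-1 * F (k + i)%N p)).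
rewrite (eq_bigr (fun i : 'I_(m.+1 - k) => T i - T i.+1)) => [|i _]; last first.
  rewrite dbarZ ?dbar_zconjXM ?dbF //; [|exact/d2/dF|exact/d2].
  rewrite [LHS]scalerDr; congr (_ + _).
  by rewrite /T scalerA component_coefS scaleNr opprK addnS.
rewrite -(big_mkord xpredT (fun i => T i - T i.+1)).
under eq_bigr do rewrite -opprB.
rewrite sumrN telescope_sumr // /T subnKC; last by rewrite ltnW.
by rewrite F0 mulr0 !scaler0 mulr0 scale0r scaler0 subrr oppr0.
Qed.

End SliceDecomposition.

Lemma slice_pt_surj (R : realType) n (x : 'rV[R]_n.+1) : (0 < n)%N ->
  exists w p, sphere w /\ x = slice_pt w p.
Proof.
move=> n0; set v := fun l : 'I_n => x 0 (lift ord0 l).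
have [s0|s0] := eqVneq (\sum_(l < n) v l ^+ 2) 0.
  (* A real point lies on every slice, so a coordinate direction is chosen. *)
  pose l0 := Ordinal n0; exists (delta_mx 0 l0), (x 0 ord0, 0); split.
    rewrite /sphere /= (bigD1 l0) //= mxE !eqxx expr1n big1 ?addr0 // => l ll0.
    by rewrite mxE (negbTE ll0) andbF expr0n.
  apply: pt_eqP => [|l]; rewrite ?slice_pt0 ?slice_ptl //= mul0r.
  apply/eqP; rewrite -sqrf_eq0.
  by have /(_ l isT) -> := (psumr_eq0P (fun l _ => sqr_ge0 (v l)) s0).
have sp : 0 < \sum_(l < n) v l ^+ 2.
  by rewrite lt_neqAle eq_sym s0 sumr_ge0 // => l _; exact: sqr_ge0.
pose N := Num.sqrt (\sum_(l < n) v l ^+ 2); have N0 : N != 0 by rewrite gt_eqF // sqrtr_gt0.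
exists (\row_l (v l / N)), (x 0 ord0, N); split.
  rewrite /sphere /=; under eq_bigr do rewrite mxE expr_div_n.
  by rewrite -mulr_suml sqr_sqrtr ?divff // ltW.
apply: pt_eqP => [|l]; rewrite ?slice_pt0 ?slice_ptl //= mxE.
by rewrite mulrC divfK.
Qed.

Section Decomposition.
Variables (R : realType) (n : nat) (Omega : set 'rV[R]_n.+1).
Hypotheses (n0 : (0 < n)%N) (asd : axially_symmetric_slice_domain Omega).
Local Notation pt := 'rV[R]_n.+1.

Lemma slice_flip w p : sphere w -> slice w Omega p -> slice w Omega (flip p).
Proof.
move=> sw; case: asd => _ _ _ sym Sp; rewrite /slice /= slice_pt_flip.
exact: sym sw (sphereN sw) Sp.
Qed.

Lemma open_Omega : open Omega. Proof. by case: asd => [[]]. Qed.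

Lemma open_slice w : sphere w -> open (slice w Omega).
Proof. by move=> sw; case: asd => _ _ /(_ w sw) []. Qed.

Lemma slice_indep w w' p : sphere w -> sphere w' -> slice w Omega p -> slice w' Omega p.
Proof. by move=> sw sw'; case: asd => _ _ _; apply. Qed.

Lemma decomposition_exists m (g : pt -> clifford R n) :
  slice_polyanalytic m.+1 Omega g ->
  exists f_, @polyanalytic_decomposition R n m.+1 Omega g f_.
Proof.
move=> [Cg [a [b [a_even b_odd gE]]] dg].
have [w0 [_ [sw0 _]]] := slice_pt_surj (0 : pt) n0.
(* By axial symmetry this set is the same for every unit w. *)
pose D := slice w0 Omega; have oD : open D := open_slice sw0.
have Df p : D p -> D (flip p) by exact: slice_flip.
have DS w p : sphere w -> D p -> slice w Omega p by move=> sw; exact: slice_indep.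
have SD w p : sphere w -> slice w Omega p -> D p by move=> sw; exact: slice_indep.
pose F w j := iter j (dbar w) (g \o slice_pt w).
have dF w j p : sphere w -> (j <= m)%N -> D p -> differentiable (F w j) p.
  move=> sw jm Dp.
  have Cg' : Ck (j + (m - j).+1) Omega g by rewrite addnS subnKC.
  have [G [dG _] GE] := iter_dbar_slice open_Omega (open_slice sw) Cg'.
  have GF : \forall z \near p, (G \o slice_pt w) z = F w j z.
    apply: filterS (open_nbhs_nbhs (conj (open_slice sw) (DS w p sw Dp))) => z Sz.
    by rewrite /F GE.
  apply: near_eq_differentiable GF _; apply: differentiable_comp.
    exact: differentiable_slice_pt.
  by apply: dG; exact: DS Dp.
have stemF j : (j <= m)%N -> stem D (F^~ j).
  elim: j => [_|j IH jm].
    exists (fun p => a p.1 p.2), (fun p => b p.1 p.2); split => [p _|p _|w sw [u v] Dp].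
    - exact: a_even.
    - exact: b_odd.
    - by apply: gE => //; exact: DS Dp.
  apply: (@stem_dbar R n D (F^~ j) w0) => //; last by apply: IH; exact: ltnW.
  by move=> w sw p Dp; apply: dF => //; exact: ltnW.
have phi_eq k w w' p p' : sphere w -> sphere w' -> D p -> D p' ->
    slice_pt w p = slice_pt w' p' -> (k <= m)%N ->
    component m w (F w) k p = component m w' (F w') k p'.
  move=> sw sw' Dp Dp' E km; apply: eq_bigr => i _.
  rewrite /zconj E; congr (_ *: (_ * _)).
  apply: (stem_well_defined (D := D) (F := F^~ (k + i)%N)) => //; apply: stemF.
  by have := ltn_ord i; rewrite ltn_subRL ltnS.
(* A point has several representations by w and p; [phi_eq] makes the value independent of them. The
   default 0 is taken only outside Omega. *)
pose f_ (k : 'I_m.+1) x := xget 0 [set y | exists w p,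
   [/\ sphere w, D p, x = slice_pt w p & y = component m w (F w) k p]].
have f_E (k : 'I_m.+1) w p : sphere w -> D p ->
    f_ k (slice_pt w p) = component m w (F w) k p.
  move=> sw Dp; rewrite /f_; case: xgetP => [y _ [w' [p' [sw' Dp' E ->]]]|].
    by apply/esym/phi_eq => //; rewrite -ltnS.
  by move=> /(_ (component m w (F w) k p)) []; exists w, p.
exists f_; split=> [k w sw p Sp|x Ox].
  have Dp := SD w p sw Sp.
  have km : (k <= m)%N by rewrite -ltnS.
  have [|//|//|dc bc] := @dbar_component R n m w (F w) k p sw km.
  - by move=> j jm; exact: dF.
  - exact: dg.
  have fc : \forall z \near p, component m w (F w) k z = (f_ k \o slice_pt w) z.
    by apply: filterS (open_nbhs_nbhs (conj oD Dp)) => z Dz; rewrite /= f_E.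
  split; first exact: near_eq_differentiable fc dc.
  by rewrite -(dbar_near w fc).
have [w [p [sw xE]]] := slice_pt_surj x n0.
have Dp : D p by apply: (SD w) => //; rewrite /slice /= -xE.
rewrite xE -[LHS](sum_component m w (F w) p).
by apply: eq_bigr => k _; rewrite f_E.
Qed.

End Decomposition.

(** * Iterated Laplacian *)

Section IteratedLaplacian.
Variables (R : realType) (n h : nat) (q r : R).
Local Notation pt := 'rV[R]_n.+1.
Hypotheses (q0 : 0 <= q) (r0 : 0 < r).
Hypothesis small : 8 * ((1 + h.+1%:R) * (n.+1%:R * r)) * q <= 1 / 2.

(** The Laplacian is local and the ball is open; the components are known as power series only
    there. *)
Lemma iter_laplacian_ext j (f g : pt -> clifford R n) :
  (forall x, `|x| < r -> f x = g x) ->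
  forall x, `|x| < r -> iter j (@laplacian R n) f x = iter j (@laplacian R n) g x.
Proof.
move=> fg; elim: j => [|j IH] x xr; first exact: fg.
have near_x (y : pt) : `|y| < r -> \forall z \near y, `|z| < r.
  by move=> yr; have near_y := near_norm_lt yr; exact: near_y.
rewrite !iterS; apply: eq_bigr => i _; apply: near_eq_derive.
apply: filterS (near_x x xr) => y yr; apply: near_eq_derive.
by apply: filterS (near_x y yr) => z zr; exact: IH.
Qed.

Lemma fueter_seriesZ j (c : R) (alpha : nat -> clifford R n) C (x : pt) :
  0 <= C -> (forall s, cnorm (alpha s) <= C * q ^+ s) -> (j <= h.+1)%N -> `|x| < r ->
  fueter_series j (fun s => c *: alpha s) x = c *: fueter_series j alpha x.
Proof.
move=> C0 aC jh xr; have cv := cvg_fueter_series q0 r0 small C0 aC jh xr.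
have c1 : series (fun s => fueter_poly j s x * (c *: alpha s)) @ \oo -->
    c *: fueter_series j alpha x.
  rewrite (_ : series _ = fun k => c *: series (fun s => fueter_poly j s x * alpha s) k).
    by apply: cvgZ; [exact: cvg_cst | exact: cv].
  apply/funext => k; rewrite /series /= scaler_sumr; apply: eq_bigr => s _.
  by rewrite scalerAr.
exact: (cvg_lim (@norm_hausdorff R (clifford R n)) c1).
Qed.

(** The i-th factor is the constant -4 j (h + 1 - j) at j = i + 1. *)
Definition laplacian_factor j : R := \prod_(i < j) (-4 * i.+1%:R * (h - i)%:R).

Lemma shift_bound (alpha : nat -> clifford R n) C (c : R) l :
  (forall s, cnorm (alpha s) <= C * q ^+ s) ->
  forall s, cnorm (c *: alpha (s + l)%N) <= (`|c| * C * q ^+ l) * q ^+ s.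
Proof.
move=> aC s; rewrite cnormZ -!mulrA -exprD addnC ler_wpM2l //.
Qed.

(** Each Laplacian raises the index by one and consumes two degrees. The condition j <= h keeps the
    index within the range of the bounds. *)
Lemma iter_laplacian_fueter_series (alpha : nat -> clifford R n) C j (x : pt) :
  n = h.*2.+1 -> 0 <= C -> (forall s, cnorm (alpha s) <= C * q ^+ s) ->
  (j <= h)%N -> `|x| < r ->
  iter j (@laplacian R n) (fueter_series 1 alpha) x =
  fueter_series j.+1 (fun s => laplacian_factor j *: alpha (s + j.*2)%N) x.
Proof.
move=> nh C0 aC; elim: j x => [|j IH] x jh xr.
  rewrite /laplacian_factor big_ord0 /=; apply: (congr1 (fun a => fueter_series 1 a x)).
  by apply/funext => s; rewrite scale1r addn0.
have jh' : (j <= h)%N by exact: ltnW.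
have := iter_laplacian_ext 1 (fun y yr => IH y jh' yr) xr; rewrite /= => ->.
set c := laplacian_factor j; set a := fun s => c *: alpha (s + j.*2)%N.
pose C' := `|c| * C * q ^+ j.*2.
have C'0 : 0 <= C' by exact: mulr_ge0 (mulr_ge0 (normr_ge0 c) C0) (exprn_ge0 _ q0).
have aC' s : cnorm (a s) <= C' * q ^+ s by exact: shift_bound.
pose C2 := `|c| * C * q ^+ j.*2.+2.
have C20 : 0 <= C2 by exact: mulr_ge0 (mulr_ge0 (normr_ge0 c) C0) (exprn_ge0 _ q0).
have aC2 s : cnorm (a s.+2) <= C2 * q ^+ s.
  have -> : a s.+2 = c *: alpha (s + j.*2.+2)%N by rewrite /a !addSn !addnS.
  exact: shift_bound.
have jh2 : (j.+2 <= h.+1)%N by [].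
rewrite (laplacian_fueter_series q0 r0 small C'0 aC' nh _ xr) //.
  rewrite -(fueter_seriesZ _ C20 aC2) //.
  apply: (congr1 (fun a => fueter_series j.+2 a x)); apply/funext => s.
  rewrite /a scalerA; congr (_ *: alpha _); last by rewrite doubleS !addSn !addnS.
  rewrite /c /laplacian_factor big_ord_recr /= natrB //.
  by set P := \prod_(_ < _) _; rewrite -[h.+1%:R]natr1 -[j.+1%:R]natr1; ring.
exact: (cvg_fueter_series q0 r0 small C20 aC2 jh2 xr).
Qed.

End IteratedLaplacian.

(** * The constants and the Appell polynomials *)

Lemma laplacian_factorE (R : realType) h :
  laplacian_factor R h h = (-1) ^+ h * 4 ^+ h * h`!%:R ^+ 2.
Proof.
rewrite /laplacian_factor; have e (i : 'I_h) :
    -4 * i.+1%:R * (h - i)%:R = -4 * (i.+1%:R * (h - i)%:R) :> R by rewrite mulrA.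
under eq_bigr do rewrite e.
rewrite big_split /= prodr_const card_ord big_split /= -exprMn mulN1r expr2.
congr (_ * (_ * _)); rewrite fact_prod natr_prod big_add1 big_mkord //.
by rewrite (reindex_inj rev_ord_inj) /=; apply: eq_bigr => i _; rewrite subKn.
Qed.

(** For n = 2h + 1 the parameters (n + 1)/2 and (n - 1)/2 are h + 1 and h; the coefficients then
    agree once the factorials are collected into a binomial coefficient. *)
Lemma fueter_poly_appell (R : realType) n h s (x : 'rV[R]_n.+1) : n = h.*2.+1 ->
  fueter_poly h.+1 s x = (pochhammer n%:R s / s`!%:R) *: appell_poly s x.
Proof.
move=> nh.
have n2 : (n%:R + 1) / 2 = h.+1%:R :> R by rewrite nh -!natr1 -muln2 natrM; field.
have n1 : (n%:R - 1) / 2 = h%:R :> R by rewrite nh -natr1 addrK -muln2 natrM mulfK // pnatr_eq0.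
rewrite /fueter_poly /rising_poly /appell_poly scaler_sumr; apply: eq_bigr => i _.
have is_ : (i <= s)%N by rewrite -ltnS.
rewrite [RHS]scalerA; congr (_ *: _); rewrite /appell_coef n2 n1.
have -> : h.+1%:R - 1 = h%:R :> R by rewrite -natr1 addrK.
rewrite /rising_coef -(bin_fact is_) !natrM.
have h1 : 'C(s, i)%:R != 0 :> R by rewrite pnatr_eq0 -lt0n bin_gt0.
have h2 := factr_neq0 R (s - i); have h3 := factr_neq0 R i.
have h4 : pochhammer n%:R s != 0 :> R.
  rewrite /pochhammer prodf_seq_neq0; apply/allP => j _ /=.
  by rewrite -natrD pnatr_eq0 nh.
by field; rewrite h1 h2 h3 h4.
Qed.

Section RealPoints.
Variables (R : realType) (n : nat).
Local Notation pt := 'rV[R]_n.+1.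

Definition real_pt (t : R) : pt := t *: delta_mx 0 0.

Lemma norm_real_pt t : `|real_pt t| <= `|t|.
Proof.
rewrite normrZ ler_piMr // [leLHS]/Num.Def.normr/= mx_normrE.
apply: bigmax_le => // -[i j] _; rewrite mxE.
by case: (_ && _); rewrite ?normr1 ?normr0.
Qed.

Lemma para_real_pt t : para (real_pt t) = t%:A :> clifford R n.
Proof.
have := para_linear t (delta_mx 0 0 : pt) 0; rewrite addr0 para_basis0 => ->.
have := para_linear (-1) (0 : pt) 0; rewrite scaler0 addr0 scaleN1r addNr => ->.
by rewrite addr0.
Qed.

Lemma para_conj_real_pt t : para_conj (real_pt t) = t%:A :> clifford R n.
Proof.
have := para_conj_linear t (delta_mx 0 0 : pt) 0; rewrite addr0 para_conj_basis0 => ->.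
have := para_conj_linear (-1) (0 : pt) 0; rewrite scaler0 addr0 scaleN1r addNr => ->.
by rewrite addr0.
Qed.

End RealPoints.

Theorem theorem7p12 (R : realType) (n m : nat) (Omega : set 'rV[R]_n.+1)
    (g : 'rV[R]_n.+1 -> clifford R n)
    (alpha beta : 'I_m.+1 -> nat -> clifford R n) :
  odd n ->
  axially_symmetric_slice_domain Omega ->
  Omega 0 ->
  slice_polyanalytic m.+1 Omega g ->
  (\forall x \near (0 : 'rV[R]_n.+1),
     has_expansion
       (fun (k : 'I_m.+1) s => para_conj x ^+ k * para x ^+ s * alpha k s)
       (g x)) ->
  (forall (k : 'I_m.+1) (s : nat),
     beta k s = (Gamma ((n%:R + 1) / 2 : R) ^+ 2 * 2 ^+ (n - 1)
                 * (-1) ^+ ((n - 1) %/ 2)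
                 * (pochhammer n%:R s / s`!%:R)) *: alpha k (s + n - 1)%N) ->
  \forall x \near (0 : 'rV[R]_n.+1),
    has_expansion (fun (k : 'I_m.+1) s => appell_A k s x * beta k s)
      (fueter_sce m.+1 Omega g x).
Proof.
move=> odd_n asd O0 gSP expansion betaE.
pose h := n./2; have nh : n = h.*2.+1 by rewrite -[LHS]odd_double_half odd_n.
have n0 : (0 < n)%N by rewrite nh.
have n1 : (n - 1 = h.*2)%N by rewrite nh subn1.
have n1h : ((n - 1) %/ 2 = h)%N by rewrite n1 divn2 doubleK.
(* Existence ensures that [xget] returns a genuine decomposition; which one is not known. *)
have /xgetPex : exists f_, @polyanalytic_decomposition R n m.+1 Omega g f_.
  exact: decomposition_exists n0 asd _ _ gSP.
move=> /(_ (fun _ _ => 0)); rewrite /fueter_sce.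
set f_ := xget _ _ => -[f_mono f_sum].
have [rho /= rho0 ball_rho] : exists2 rho : R, 0 < rho & forall x : 'rV[R]_n.+1, `|x| < rho ->
    Omega x /\ has_expansion
       (fun (k : 'I_m.+1) s => para_conj x ^+ k * para x ^+ s * alpha k s) (g x).
  have oO : \forall x \near (0 : 'rV[R]_n.+1), Omega x.
    by apply: open_nbhs_nbhs; split => //; exact: open_Omega asd.
  have [rho rho0 P] := (@nbhs_norm0P R 'rV[R]_n.+1 _).1 (filterI oO expansion).
  by exists rho => // x xr; exact: P.
(* A real point inside the ball where the expansion holds, from which the coefficient bounds are
   read. *)
pose t := rho / 2; have t0 : 0 < t by rewrite divr_gt0.
have coefs k : exists2 C, 0 <= C & forall s, cnorm (alpha k s) <= C * t^-1 ^+ s.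
  apply: (coefficient_bound (k := k) t0).
  have tr : `|real_pt n t| < rho.
    apply: le_lt_trans (norm_real_pt n t) _; rewrite gtr0_norm //.
    by rewrite ltr_pdivrMr // ltr_pMr // ltr1n.
  have [_ [/(_ k) cv _]] := ball_rho _ tr.
  by rewrite para_real_pt para_conj_real_pt in cv.
pose q := t^-1; have q0 : 0 <= q by rewrite invr_ge0 ltW.
pose K : R := (1 + h.+1%:R) * n.+1%:R.
have K0 : 0 < K by rewrite mulr_gt0 // ltr_pwDl.
(* At the radius t / (16 K) the left side of [small] equals 8/16. *)
pose r := Num.min rho (t / (16 * K)).
have r0 : 0 < r by rewrite lt_min rho0 divr_gt0 // mulr_gt0.
have small : 8 * ((1 + h.+1%:R) * (n.+1%:R * r)) * q <= 1 / 2.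
  have rK : r <= t / (16 * K) by rewrite ge_min lexx orbT.
  apply: (@le_trans _ _ (8 * (K * (t / (16 * K))) * q)).
    by rewrite ler_wpM2r // ler_wpM2l // mulrA ler_wpM2l // ltW.
  have tn : t != 0 by rewrite gt_eqF.
  have Kn : K != 0 by rewrite gt_eqF.
  by rewrite le_eqVlt; apply/orP; left; apply/eqP; rewrite /q; field; rewrite Kn tn.
have r_rho (x : 'rV[R]_n.+1) : `|x| < r -> `|x| < rho.
  by move=> xr; apply: lt_le_trans xr _; rewrite ge_min lexx.
(* Identifies the selected components with the power series. On the slice through [x] the
   differences are annihilated by dbar, and weighted by the powers of [zconj] they sum to g - g = 0,
   so [polyanalytic_unique] applies. *)
have fE k x : `|x| < r -> f_ k x = fueter_series 1 (alpha k) x.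
  move=> xr; have [w [p [sw xE]]] := slice_pt_surj x n0.
  pose U := [set z | `|slice_pt w z| < r].
  have oU : open U.
    apply: (@open_comp _ _ (slice_pt w) [set y | `|y| < r]).
      by move=> z _; exact: continuous_slice_pt.
    by rewrite openE => y yr; have near_y := near_norm_lt yr; exact: near_y.
  have US z : U z -> slice w Omega z by move=> /r_rho /ball_rho [].
  pose H (k : 'I_m.+1) z := (f_ k \o slice_pt w) z - (fueter_series 1 (alpha k) \o slice_pt w) z.
  suff : H k p = 0 by rewrite /H /= -xE => /eqP; rewrite subr_eq0 => /eqP.
  apply: (@polyanalytic_unique R n w U m.+1 H) => //; last by rewrite /U /= -xE.
    move=> j z Uz; have [df dbf] := f_mono j w sw z (US z Uz).
    have [C C0 aC] := coefs j.
    have [ds dbs] := slice_monogenic_fueter_series q0 r0 small C0 aC sw Uz.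
    have d2 : derivable2 (f_ j \o slice_pt w) z by split; exact: diff_derivable.
    by split; [exact: derivable2B | rewrite dbarB // dbf dbs subrr].
  move=> z Uz; have [_ [cv gE]] := ball_rho _ (r_rho _ Uz).
  transitivity (g (slice_pt w z) - g (slice_pt w z)); last exact: subrr.
  rewrite {1}(f_sum _ (US z Uz)) gE -sumrB; apply: eq_bigr => j _.
  rewrite /H /= (mulrBr (zconj w z ^+ j)); congr (_ - _).
  have [C C0 aC] := coefs j.
  have c := cvg_cmull_series (c := zconj w z ^+ j)
    (cvg_fueter_series q0 r0 small C0 aC (isT : (1 <= h.+1)%N) Uz).
  rewrite -(cvg_lim (@norm_hausdorff R (clifford R n)) c); congr (limn (series _)).
  by apply/funext => s; rewrite fueter_poly1E mulrA.
have fact_sq : Gamma ((n%:R + 1) / 2 : R) = h`!%:R.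
  have -> : (n%:R + 1) / 2 = h.+1%:R :> R by rewrite nh -!natr1 -muln2 natrM; field.
  exact: Gamma_nat.
have near_r : \forall x \near (0 : 'rV[R]_n.+1), `|x| < r.
  by apply: near_norm_lt; rewrite normr0.
apply: filterS near_r => x xr.
have key k : series (fun s => appell_poly s x * beta k s) @ \oo -->
    iter ((n - 1) %/ 2) (@laplacian R n) (f_ k) x.
  have [C C0 aC] := coefs k.
  rewrite n1h (iter_laplacian_ext h (fE k) xr).
  rewrite (iter_laplacian_fueter_series q0 r0 small nh C0 aC (leqnn h) xr).
  have aC' := shift_bound (laplacian_factor R h h) h.*2 aC.
  have C'0 : 0 <= `|laplacian_factor R h h| * C * q ^+ h.*2.
    exact: mulr_ge0 (mulr_ge0 (normr_ge0 _) C0) (exprn_ge0 _ q0).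
  have cv := cvg_fueter_series q0 r0 small C'0 aC' (leqnn h.+1) xr.
  rewrite (_ : (fun s => appell_poly s x * beta k s) = fun s => fueter_poly h.+1 s x *
     (laplacian_factor R h h *: alpha k (s + h.*2)%N)); first exact: cv.
  apply/funext => s; rewrite betaE (fueter_poly_appell s x nh) -addnBA // n1.
  rewrite -(scalerAr _ (appell_poly s x)) -(scalerAl _ (appell_poly s x)).
  rewrite -(scalerAr _ (appell_poly s x)) scalerA; congr (_ *: _).
  (* It remains to match constants: the Gamma factor is (h!)^2 and 2^(n-1) = 4^h. *)
  rewrite fact_sq laplacian_factorE -muln2 mulnK // mulnC exprM.
  have -> : 2 ^+ 2 = 4 :> R by rewrite -natrX.
  by ring.
have keyA (k : 'I_m.+1) : series (fun s => appell_A k s x * beta k s) @ \oo -->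
    re x ^+ k *: iter ((n - 1) %/ 2) (@laplacian R n) (f_ k) x.
  rewrite (_ : series _ = fun N => re x ^+ k *: series (fun s => appell_poly s x * beta k s) N).
    by apply: cvgZ; [exact: cvg_cst | exact: key].
  apply/funext => N; rewrite /series /= scaler_sumr; apply: eq_bigr => s _.
  by rewrite /appell_A -(scalerAl _ (appell_poly s x)).
split; first by move=> k; apply/cvg_ex; eexists; exact: keyA.
apply: eq_bigr => k _; apply/esym.
exact: (cvg_lim (@norm_hausdorff R (clifford R n)) (keyA k)).
Qed.
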